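(* For every real number $\epsilon \in (0,1]$ there are constants $\zeta = \zeta(\epsilon)$ and $C = C(\epsilon)$ such that for every prime number $p$ there exist positive integers $q$ and $a$ with $0<a<q$, $\gcd(a,q)=1$, $q \le C p^{1+\epsilon}$ and $q \equiv 0 \pmod p$, such that all partial quotients $b_1,\dots,b_s$ in the regular continued fraction expansion $a/q = [0;b_1,\dots,b_s]$ satisfy $b_j \le \zeta$ for $1 \le j \le s$.
   Context: For coprime positive integers $0<a<q$, the regular continued fraction expansion is the unique representation $\frac{a}{q} = [0;b_1,\dots,b_s] = \cfrac{1}{b_1+\cfrac{1}{b_2+\cdots+\cfrac{1}{b_s}}}$ with positive integers $b_j$ and $b_s\ge 2$ (obtained by the Euclidean algorithm); the $b_j$ are the partial quotients. *)

(* Defs.v *)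
From Stdlib Require Import Reals Arith List Znumtheory ZArith.
Open Scope R_scope.

Fixpoint cf_aux (fuel a q : nat) : list nat :=
  match fuel with
  | O => nil
  | S f => match a with
           | O => nil
           | _ => (q / a)%nat :: cf_aux f (q mod a)%nat a
           end
  end.

(* Partial quotients of the regular continued fraction of a/q (0 < a < q);
   fuel q+1 is always enough since a strictly decreases. *)
Definition partial_quotients (a q : nat) : list nat := cf_aux (S q) a q.

(* Main.v *)
(* Fractions with partial quotients at most Q correspond to words in the matrices [0 1; 1 b] with b <= Q.
   Let X be the set of lines of F_p^2 spanned by the vectors (a, q), where a/q runs over such fractions with
   q at most p^(1/2), and let A be the set of matrices of such words of norm at most N, about p^(1/k).
   If y^T g x = 0 modulo p with x, y in X and g in A, then the concatenation of the reversed word of y, of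
   the word of g and of the word of x has a denominator divisible by p and at most 4 p N.

   A solution exists by an argument in the style of Sarnak and Xue. Without one, the averaging operator of A
   on functions on the projective line with mean zero has norm close to 1. Quasirandomness of SL_2(F_p)
   (Cauchy-Schwarz and an average over all 2x2 matrices) bounds a power of that norm by the number of products of 4k
   factors from A and its inverse that are 1 modulo p. Over the integers, a matrix g is such a product in at
   most N^(4k + o(1)) / |g| ways, and the matrices congruent to 1 modulo p are sparse, because their trace is
   2 modulo p^2 and the divisor bound controls the other entries. When Q is large, A and X have nearly the
   sizes N^2 and p of their ambient sets, which contradicts this bound for large p; for small p take 1/p. *)

Require Import Defs.
From Stdlib Require Import Reals Arith List Znumtheory ZArith Lia Lra.
From mathcomp Require all_boot all_order all_algebra all_solvable.
From mathcomp Require ring lra zify.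
Open Scope R_scope.

Module BoundedQuotients.
Import all_boot all_order all_algebra all_solvable ring lra zify.
Set Implicit Arguments. Unset Strict Implicit. Unset Printing Implicit Defensive.
Import Order.TTheory GRing.Theory Num.Theory.
Local Open Scope ring_scope.

(** * Quasirandomness of SL2 over a finite field *)

Definition vec (R : Type) := (R * R)%type.
Definition mat (R : Type) := (vec R * vec R)%type.

Section Mat.
Variable R : comNzRingType.
Implicit Types (g h : mat R) (v w : vec R).

Definition mulv g v : vec R :=
  (g.1.1 * v.1 + g.1.2 * v.2, g.2.1 * v.1 + g.2.2 * v.2).
Definition mulm g h : mat R :=
  ((g.1.1 * h.1.1 + g.1.2 * h.2.1, g.1.1 * h.1.2 + g.1.2 * h.2.2),
   (g.2.1 * h.1.1 + g.2.2 * h.2.1, g.2.1 * h.1.2 + g.2.2 * h.2.2)).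
Definition onem : mat R := ((1, 0), (0, 1)).
(** The adjugate stands in for the inverse: it needs no division, inverts matrices of determinant 1,
    and commutes with reduction modulo [p]. *)
Definition adjm g : mat R := ((g.2.2, - g.1.2), (- g.2.1, g.1.1)).
Definition detm g := g.1.1 * g.2.2 - g.1.2 * g.2.1.
Definition detv v w := v.1 * w.2 - v.2 * w.1.
Definition scalev (l : R) v : vec R := (l * v.1, l * v.2).
Definition scalem (l : R) g : mat R := (scalev l g.1, scalev l g.2).

Lemma mulmA g h k : mulm g (mulm h k) = mulm (mulm g h) k.
Proof. by congr ((_, _), (_, _)) => /=; ring. Qed.
Lemma mul1m g : mulm onem g = g.
Proof. by case: g => [[a b] [c d]]; congr ((_, _), (_, _)) => /=; ring. Qed.
Lemma mulm1 g : mulm g onem = g.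
Proof. by case: g => [[a b] [c d]]; congr ((_, _), (_, _)) => /=; ring. Qed.
Lemma mulmv g h v : mulv (mulm g h) v = mulv g (mulv h v).
Proof. by congr (_, _) => /=; ring. Qed.
Lemma mul1v v : mulv onem v = v.
Proof. by case: v => a b; congr (_, _) => /=; ring. Qed.
Lemma detmM g h : detm (mulm g h) = detm g * detm h.
Proof. by rewrite /detm /=; ring. Qed.
Lemma detm1 : detm onem = 1.
Proof. by rewrite /detm /=; ring. Qed.
Lemma detm_adj g : detm (adjm g) = detm g.
Proof. by rewrite /detm /=; ring. Qed.
Lemma adjmM g h : adjm (mulm g h) = mulm (adjm h) (adjm g).
Proof. by congr ((_, _), (_, _)) => /=; ring. Qed.
Lemma adjmK : involutive adjm.
Proof. by case=> [[a b] [c d]]; rewrite /adjm /= !opprK. Qed.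
Lemma adjm1 : adjm onem = onem.
Proof. by rewrite /adjm /= oppr0. Qed.
Lemma mul_adjm g : detm g = 1 -> mulm (adjm g) g = onem.
Proof.
by case: g => [[a b] [c d]] /= dg; congr ((_, _), (_, _)) => /=;
  rewrite -?dg /detm /=; ring.
Qed.
Lemma mulm_adj g : detm g = 1 -> mulm g (adjm g) = onem.
Proof. by move=> dg; rewrite -{1}(adjmK g) mul_adjm // detm_adj. Qed.
Lemma adjKv g v : detm g = 1 -> mulv (adjm g) (mulv g v) = v.
Proof. by move=> dg; rewrite -mulmv mul_adjm // mul1v. Qed.
Lemma mulKv g v : detm g = 1 -> mulv g (mulv (adjm g) v) = v.
Proof. by move=> dg; rewrite -mulmv mulm_adj // mul1v. Qed.
Lemma mulv_inj g : detm g = 1 -> injective (mulv g).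
Proof. by move=> dg; apply: (can_inj (g := mulv (adjm g))) => v; rewrite adjKv. Qed.
Lemma mulv_scale g l v : mulv g (scalev l v) = scalev l (mulv g v).
Proof. by congr (_, _) => /=; ring. Qed.
Lemma scalemv l g v : mulv (scalem l g) v = scalev l (mulv g v).
Proof. by congr (_, _) => /=; ring. Qed.
Lemma detm_scale l g : detm (scalem l g) = l ^+ 2 * detm g.
Proof. by rewrite /detm /=; ring. Qed.
End Mat.
Arguments onem {R}.

Section QuasiRandom.
Variables (F : finFieldType) (R : realFieldType).
Local Notation q := (#|F|%:R : R).
Variable f : vec F -> R.
Hypothesis f_hom : forall l v, l != 0 -> f (scalev l v) = f v.
Hypothesis f_0 : f 0 = 0.
Hypothesis f_sum : \sum_v f v = 0.
Local Notation nf := (\sum_v f v ^+ 2).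

(** A matrix is determined by its values on a basis. Being injective on a finite type, the map is a
    permutation and serves to reindex sums. *)
Lemma pair_mulv_inj (x y : vec F) : detv x y != 0 ->
  injective (fun g : mat F => (mulv g x, mulv g y) : mat F).
Proof.
move=> dn [[a b] [c d]] [[a' b'] [c' d']]; case: x dn => x1 x2; case: y => y1 y2.
rewrite /detv /= => dn [e1 e2 e3 e4].
have key (u v u' v' : F) : u * x1 + v * x2 = u' * x1 + v' * x2 ->
    u * y1 + v * y2 = u' * y1 + v' * y2 -> u = u' /\ v = v'.
  move=> h1 h2; split; apply: (mulIf dn).
    have -> : u * (x1 * y2 - x2 * y1) = (u * x1 + v * x2) * y2 - (u * y1 + v * y2) * x2 by ring.
    by rewrite h1 h2; ring.
  have -> : v * (x1 * y2 - x2 * y1) = (u * y1 + v * y2) * x1 - (u * x1 + v * x2) * y1 by ring.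
  by rewrite h1 h2; ring.
by have [-> ->] := key _ _ _ _ e1 e3; have [-> ->] := key _ _ _ _ e2 e4.
Qed.

(** The images of [x] and [y] run over all pairs of vectors, so the sum factors and [f_sum] kills
    it. *)
Lemma gram_indep x y : detv x y != 0 -> \sum_(g : mat F) f (mulv g x) * f (mulv g y) = 0.
Proof.
move=> dn; have := reindex_inj (pair_mulv_inj dn) (op := +%R) (P := xpredT)
  (F := fun g => f g.1 * f g.2) => /= <-.
rewrite -(pair_bigA _ (fun u v => f u * f v)) /=.
by under eq_bigr do rewrite -mulr_sumr f_sum mulr0; rewrite big1.
Qed.

(** Complete [x] to a basis: each vector is the image of [x] under exactly q^2 matrices. *)
Lemma gram_diag x : x != 0 -> \sum_(g : mat F) f (mulv g x) ^+ 2 = q ^+ 2 * nf.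
Proof.
move=> xn; have [y dn] : exists y, detv x y != 0.
  case: x xn => x1 x2 xn; case: (eqVneq x1 0) => [e|n1].
    exists (-1, 0); rewrite /detv /= e mul0r sub0r mulrN opprK mulr1.
    by apply: contra xn => /eqP ->; rewrite e.
  by exists (0, 1); rewrite /detv /= mulr1 mulr0 subr0.
have := reindex_inj (pair_mulv_inj dn) (op := +%R) (P := xpredT)
  (F := fun g => f g.1 ^+ 2) => /= <-.
rewrite -(pair_bigA _ (fun u v => f u ^+ 2)) /=.
under eq_bigr do rewrite sumr_const.
rewrite mulr_sumr; apply: eq_bigr => u _.
by rewrite card_prod -[LHS]mulr_natl natrM expr2.
Qed.

Lemma sum_parallel (x : vec F) (h : vec F -> R) : x != 0 ->
  \sum_(y | detv x y == 0) h y = \sum_(l : F) h (scalev l x).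
Proof.
move=> xn; have inj : injective (fun l => scalev l x).
  move=> l m [e1 e2]; case: x xn e1 e2 => x1 x2 /= xn e1 e2.
  case: (eqVneq x1 0) => [e|n1]; last exact: (mulIf n1).
  by apply: (mulIf _ e2); apply: contra xn => /eqP ->; rewrite e.
rewrite -(big_imset (h := fun l => scalev l x) (A := predT) h) /=; last by move=> l m _ _; exact: inj.
apply: eq_bigl => y; apply/eqP/imsetP => [|[l _ ->]]; last by rewrite /detv /=; ring.
case: x xn {inj} => x1 x2; case: y => y1 y2; rewrite /detv /= => xn /eqP; rewrite subr_eq0 => /eqP e.
case: (eqVneq x1 0) => [e1|n1].
  have n2 : x2 != 0 by apply: contra xn => /eqP ->; rewrite e1.
  exists (y2 / x2) => //; rewrite /scalev /= e1 mulr0 divfK //; congr (_, _).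
  by apply: (mulfI n2); rewrite -e e1 mul0r mulr0.
exists (y1 / x1) => //; rewrite /scalev /= divfK //; congr (_, _).
by apply: (mulfI n1); rewrite e mulrA mulrCA divff // mulr1 mulrC.
Qed.

(** Expanding the square gives a sum over pairs of vectors. Independent pairs contribute 0, and by
    homogeneity the q - 1 nonzero multiples of [x] contribute equally. *)
Lemma sum_mat_correl :
  \sum_(g : mat F) (\sum_v f (mulv g v) * f v) ^+ 2 = q ^+ 2 * (q - 1) * nf ^+ 2.
Proof.
pose G x y : R := \sum_(g : mat F) f (mulv g x) * f (mulv g y).
transitivity (\sum_x \sum_y f x * (f y * G x y)).
  under eq_bigr => g _ do rewrite expr2 mulr_suml.
  rewrite exchange_big /=; apply: eq_bigr => x _.
  under eq_bigr => g _ do rewrite mulr_sumr.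
  rewrite exchange_big /=; apply: eq_bigr => y _.
  by rewrite /G !mulr_sumr; apply: eq_bigr => g _; ring.
transitivity (\sum_x f x ^+ 2 * (q ^+ 2 * (q - 1) * nf)); last by rewrite -mulr_suml; ring.
apply: eq_bigr => x _; case: (eqVneq x 0) => [->|xn].
  by rewrite f_0 expr0n mul0r big1 // => y _; rewrite mul0r.
rewrite -mulr_sumr expr2 -mulrA; congr (_ * _).
rewrite (bigID (fun y => detv x y == 0)) /= addrC big1 ?add0r; last first.
  by move=> y dn; rewrite /G gram_indep ?mulr0.
rewrite sum_parallel // (bigD1 0) //=.
have -> : scalev 0 x = 0 by rewrite /scalev !mul0r.
rewrite f_0 mul0r add0r.
rewrite (eq_bigr (fun=> f x * (q ^+ 2 * nf))); last first.
  move=> l ln; rewrite f_hom //; congr (_ * _); rewrite -(gram_diag xn).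
  by apply: eq_bigr => g _; rewrite mulv_scale f_hom.
rewrite sumr_const (_ : #|_| = #|F|.-1); last by rewrite cardC1.
rewrite -[LHS]mulr_natl.
have -> : (#|F|.-1%:R : R) = q - 1.
  by rewrite -{2}(prednK (ltnW (card_finNzRing_gt1 F))) -natr1 addrK.
ring.
Qed.

Lemma card_sqrt_le2 (d : F) : (#|[pred l : F | l ^+ 2 == d]| <= 2)%N.
Proof.
case: (pickP [pred l : F | l ^+ 2 == d]) => [l0 /= /eqP <-|none]; last by rewrite eq_card0.
apply: (leq_trans (n := #|[set l0; - l0]|)); last by rewrite cards2; case: (_ != _).
by apply: subset_leq_card; apply/subsetP => l; rewrite !inE eqf_sqr.
Qed.

(* Each matrix is [l *: g] for at most two pairs [(l, g)] with [det g = 1], since [l ^+ 2] is its determinant. *)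
Lemma sum_sl2_le_mat (phi : mat F -> R) :
  (forall g, 0 <= phi g) -> (forall l g, l != 0 -> phi (scalem l g) = phi g) ->
  (q - 1) * \sum_(g | detm g == 1) phi g <= 2 * \sum_g phi g.
Proof.
move=> phi0 phis.
have qE : q - 1 = \sum_(l : F | l != 0) 1.
  rewrite sumr_const (_ : #|_| = #|F|.-1); last by rewrite cardC1.
  by rewrite -{1}(prednK (ltnW (card_finNzRing_gt1 F))) -natr1 addrK.
rewrite qE mulr_suml.
have -> : \sum_(l : F | l != 0) 1 * \sum_(g | detm g == 1) phi g =
          \sum_(l : F | l != 0) \sum_(g | detm g == l ^+ 2) phi g.
  apply: eq_bigr => l ln; rewrite mul1r.
  rewrite [RHS](reindex_inj (h := scalem l)) /=; last first.
    by move=> [[a b] [c d]] [[a' b'] [c' d']] [] /(mulfI ln) -> /(mulfI ln) -> /(mulfI ln) -> /(mulfI ln) ->.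
  apply: eq_big => [g|g _]; last by rewrite phis.
  by rewrite -(inj_eq (mulfI (expf_neq0 2 ln)) (detm g)) detm_scale mulr1.
rewrite (exchange_big_dep xpredT) //= mulr_sumr; apply: ler_sum => g _.
rewrite sumr_const -[leLHS]mulr_natl; apply: ler_wpM2r => //.
rewrite ler_nat; apply: leq_trans (card_sqrt_le2 (detm g)).
by apply: subset_leq_card; apply/subsetP => l; rewrite !inE eq_sym => /andP[].
Qed.

(** Each correlation is at most [nf] in absolute value and there are about q^3 matrices of
    determinant 1. The factor q saved over this trivial bound is the quasirandomness. *)
Lemma sum_sl2_correl :
  \sum_(g : mat F | detm g == 1) (\sum_v f (mulv g v) * f v) ^+ 2 <= 2 * q ^+ 2 * nf ^+ 2.
Proof.
have q1 : 0 < q - 1 by rewrite subr_gt0 ltr1n card_finNzRing_gt1.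
rewrite -(ler_pM2l q1).
have -> : (q - 1) * (2 * q ^+ 2 * nf ^+ 2) = 2 * (q ^+ 2 * (q - 1) * nf ^+ 2) by ring.
rewrite -sum_mat_correl; apply: sum_sl2_le_mat => [g|l g ln]; first exact: sqr_ge0.
by congr (_ ^+ 2); apply: eq_bigr => v _; rewrite scalemv f_hom.
Qed.
End QuasiRandom.

(** * Mixing from few collisions *)

Section Prods.
Variables (R : comNzRingType).

(** Repetitions are kept: the multiplicity of a matrix is its number of representations as a
    product, as in a convolution power. *)
Fixpoint prods (E : seq (mat R)) (m : nat) : seq (mat R) :=
  if m is m'.+1 then [seq mulm e x | e <- E, x <- prods E m'] else [:: onem].

Definition quotients (A : seq (mat R)) : seq (mat R) :=
  [seq mulm b (adjm a) | a <- A, b <- A].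

Variable S : nmodType.
Implicit Type phi : mat R -> S.

Lemma sum_prodsS E m phi :
  \sum_(z <- prods E m.+1) phi z = \sum_(e <- E) \sum_(x <- prods E m) phi (mulm e x).
Proof. by rewrite /= big_allpairs_dep. Qed.

Lemma sum_prodsD E m n phi :
  \sum_(z <- prods E (m + n)) phi z =
  \sum_(x <- prods E m) \sum_(y <- prods E n) phi (mulm x y).
Proof.
elim: m phi => [|m IH] phi.
  by rewrite add0n big_seq1; apply: eq_bigr => y _; rewrite mul1m.
rewrite addSn !sum_prodsS; apply: eq_bigr => e _; rewrite IH.
by apply: eq_bigr => x _; apply: eq_bigr => y _; rewrite mulmA.
Qed.

(** The inverse of b a^-1 is a b^-1, so exchanging the two summations suffices. *)
Lemma sum_quotients_adj A phi :
  \sum_(e <- quotients A) phi (adjm e) = \sum_(e <- quotients A) phi e.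
Proof.
rewrite /quotients !big_allpairs_dep exchange_big /=.
by apply: eq_bigr => a _; apply: eq_bigr => b _; rewrite adjmM adjmK.
Qed.

Lemma sum_prods_adj A m phi :
  \sum_(z <- prods (quotients A) m) phi (adjm z) = \sum_(z <- prods (quotients A) m) phi z.
Proof.
elim: m phi => [|m IH] phi; first by rewrite !big_seq1 adjm1.
rewrite sum_prodsS -[in RHS]addn1 sum_prodsD.
transitivity (\sum_(e <- quotients A) \sum_(x <- prods (quotients A) m) phi (mulm x (adjm e))).
  apply: eq_bigr => e _; rewrite -(IH (fun x => phi (mulm x (adjm e)))).
  by apply: eq_bigr => x _; rewrite adjmM.
rewrite exchange_big; apply: eq_bigr => x _.
rewrite (sum_quotients_adj A (fun e => phi (mulm x e))) [RHS]sum_prodsS.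
by apply: eq_bigr => e _; rewrite big_seq1 mulm1.
Qed.

Lemma detm_prods A m z : all (fun a => detm a == 1) A -> z \in prods (quotients A) m -> detm z = 1.
Proof.
move=> /allP hA; elim: m z => [|m IH] z; first by rewrite inE => /eqP ->; rewrite detm1.
move=> /allpairsP[[e x] /= [/allpairsP[[a b] /= [ha hb ->]] hx ->]].
by rewrite !detmM detm_adj (IH _ hx) (eqP (hA _ ha)) (eqP (hA _ hb)) !mul1r.
Qed.
End Prods.

(** Lagrange's identity: twice the difference of the two sides is the sum of the squares of u_i w_j
    - u_j w_i. *)
Lemma cauchy_schwarz (R : realFieldType) (I : finType) (P : pred I) (u w : I -> R) :
  (\sum_(i | P i) u i * w i) ^+ 2 <= (\sum_(i | P i) u i ^+ 2) * (\sum_(i | P i) w i ^+ 2).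
Proof.
set U := \sum_(i | P i) u i ^+ 2; set W := \sum_(i | P i) w i ^+ 2.
set V := \sum_(i | P i) _.
have : 0 <= \sum_(i | P i) \sum_(j | P j) (u i * w j - u j * w i) ^+ 2.
  by apply: sumr_ge0 => i _; apply: sumr_ge0 => j _; exact: sqr_ge0.
rewrite (_ : \sum_(i | P i) _ = U * W + W * U - 2 * (V * V)); first by move=> h; lra.
rewrite /U /W /V !mulr_suml [2 * _]mulr_sumr -big_split -sumrB; apply: eq_bigr => i _ /=.
rewrite ![_ * (\sum_(_ | _) _)]mulr_sumr ?mulr_sumr -big_split -sumrB; apply: eq_bigr => j _ /=.
ring.
Qed.

Section Mixing.
Variables (F : finFieldType) (R : realFieldType).
Local Notation q := (#|F|%:R : R).
Variables (f : vec F -> R) (A : seq (mat F)).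
Hypothesis f_hom : forall l v, l != 0 -> f (scalev l v) = f v.
Hypothesis f_0 : f 0 = 0.
Hypothesis f_sum : \sum_v f v = 0.
Hypothesis detA : all (fun a => detm a == 1) A.
Local Notation nf := (\sum_v f v ^+ 2).
Local Notation P m := (prods (quotients A) m).

Definition correl (g : mat F) : R := \sum_v f (mulv g v) * f v.
Definition correl_prods m : R := \sum_(z <- P m) correl z.

Lemma nf_ge0 : 0 <= nf.
Proof. by apply: sumr_ge0 => v _; exact: sqr_ge0. Qed.

Lemma correl_shift g h : detm g = 1 -> \sum_v f (mulv g v) * f (mulv h v) = correl (mulm h (adjm g)).
Proof.
move=> dg; rewrite [RHS](reindex_inj (mulv_inj dg)) /=; apply: eq_bigr => v _.
by rewrite mulmv adjKv // mulrC.
Qed.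

(** A change of variables turns each term into an inner product of two translates of [f], so the
    total is a squared norm. *)
Lemma correl_prods1 : correl_prods 1 = \sum_v (\sum_(a <- A) f (mulv a v)) ^+ 2.
Proof.
rewrite /correl_prods big_allpairs_dep; under eq_bigr => e _ do rewrite big_seq1 mulm1.
rewrite big_allpairs_dep big_seq.
under eq_bigr => a ha do
  under eq_bigr => b _ do rewrite -(correl_shift _ (eqP (allP detA _ ha))).
rewrite -big_seq; under eq_bigr do rewrite exchange_big /=.
rewrite exchange_big /=; apply: eq_bigr => v _.
under eq_bigr do rewrite -mulr_sumr.
by rewrite -mulr_suml -expr2.
Qed.

Lemma correl_prods_ge0 : 0 <= correl_prods 1.
Proof. by rewrite correl_prods1; apply: sumr_ge0 => v _; exact: sqr_ge0. Qed.

(* The sum over [P m] is the [m]-th power of a self-adjoint operator, applied to [f] and paired with [f]. *)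
Lemma correl_prods_double m : correl_prods m ^+ 2 <= correl_prods (m + m) * nf.
Proof.
have -> : correl_prods m = \sum_v (\sum_(z <- P m) f (mulv z v)) * f v.
  by rewrite /correl_prods exchange_big /=; apply: eq_bigr => v _; rewrite mulr_suml.
apply: (le_trans (cauchy_schwarz _ _ _)).
apply: ler_wpM2r; first exact: nf_ge0.
rewrite le_eqVlt; apply/orP; left; apply/eqP.
under eq_bigr => v _ do rewrite expr2 mulr_suml; rewrite exchange_big /=.
rewrite /correl_prods sum_prodsD.
under [RHS]eq_bigr => x _ do rewrite -(sum_prods_adj A m (fun y => correl (mulm x y))).
rewrite [RHS]exchange_big big_seq [RHS]big_seq; apply: eq_bigr => g hg.
under eq_bigr => v _ do rewrite mulr_sumr.
rewrite exchange_big /=; apply: eq_bigr => h _.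
by rewrite correl_shift // (detm_prods detA hg).
Qed.

(** Repeated use of [correl_prods_double]; the powers of [nf] make both sides homogeneous of the
    same degree in [f]. *)
Lemma correl_prods_pow i : correl_prods 1 ^+ (2 ^ i) * nf <= correl_prods (2 ^ i) * nf ^+ (2 ^ i).
Proof.
elim: i => [|i IH]; first by rewrite !expn0 !expr1.
rewrite expnS mul2n -addnn !exprD.
have [/eqP e0|nf_gt0] := boolP (nf == 0).
  by rewrite e0 mulr0 expr0n expn_eq0 /= !mulr0.
have nfp : 0 < nf by rewrite lt_def nf_gt0 nf_ge0.
rewrite -(ler_pM2r nfp).
set Q1 := correl_prods 1 in IH *; set Qi := correl_prods (2 ^ i) in IH.
set c := Q1 ^+ _ in IH *; set d := nf ^+ _ in IH *.
have c0 : 0 <= c by rewrite exprn_ge0 // correl_prods_ge0.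
apply: (le_trans (y := (Qi * d) ^+ 2)).
  have -> : c * c * nf * nf = (c * nf) ^+ 2 by ring.
  by rewrite lerXn2r ?nnegrE // ?(le_trans _ IH) // mulr_ge0 // ltW.
have -> : correl_prods (2 ^ i + 2 ^ i) * (d * d) * nf = correl_prods (2 ^ i + 2 ^ i) * nf * d ^+ 2 by ring.
by rewrite exprMn ler_wpM2r ?sqr_ge0 // correl_prods_double.
Qed.

(** Two products agree exactly when x^-1 y = 1, and the inverses of the products form the same list
    up to order. *)
Lemma collisions_prods m :
  (\sum_(x <- P m) \sum_(y <- P m) (x == y) = count_mem onem (P (m + m)))%N.
Proof.
rewrite -sum1_count [RHS]big_mkcond /=.
pose phi x : nat := (\sum_(y <- P m) (if mulm x y == onem then 1 else 0))%N.
have E := etrans (sum_prodsD (quotients A) m m (fun z => if z == onem then 1 else 0)%N)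
  (esym (sum_prods_adj A m phi)).
apply: (etrans _ (esym E)); rewrite /phi {E phi}.
rewrite big_seq [RHS]big_seq; apply: eq_bigr => x hx; apply: eq_bigr => y _.
have dx := detm_prods detA hx.
suff -> : (x == y) = (mulm (adjm x) y == onem) by case: eqP.
apply/eqP/eqP => [<-|e]; first by rewrite mul_adjm.
by rewrite -[y]mul1m -(mulm_adj dx) -mulmA e mulm1.
Qed.

(** Group equal products and apply Cauchy-Schwarz over determinant 1: the squared multiplicities
    count collisions, and [sum_sl2_correl] bounds the squared correlations. *)
Lemma correl_prods_collisions m :
  correl_prods m ^+ 2 <= (count_mem onem (P (m + m)))%:R * (2 * q ^+ 2 * nf ^+ 2).
Proof.
pose cnt g : R := \sum_(x <- P m) (x == g)%:R.
have -> : correl_prods m = \sum_(g | detm g == 1) cnt g * correl g.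
  rewrite /correl_prods big_seq.
  under [RHS]eq_bigr => g _ do rewrite /cnt big_seq mulr_suml.
  rewrite [RHS]exchange_big /=; apply: eq_bigr => x hx.
  rewrite (bigD1 x) /=; last by rewrite (detm_prods detA hx).
  rewrite eqxx mul1r big1 ?addr0 // => g /andP[_ /negPf]; rewrite eq_sym => ->.
  by rewrite mul0r.
apply: (le_trans (cauchy_schwarz _ _ _)).
apply: ler_pM; first by apply: sumr_ge0 => g _; exact: sqr_ge0.
- by apply: sumr_ge0 => g _; exact: sqr_ge0.
- rewrite -collisions_prods.
  apply: (le_trans (y := \sum_g cnt g ^+ 2)).
    by rewrite [leRHS](bigID (fun g => detm g == 1)) /= lerDl sumr_ge0 // => g _; exact: sqr_ge0.
  rewrite natr_sum (_ : \sum_g _ = \sum_(x <- P m) cnt x); last first.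
    under eq_bigr => g _ do rewrite expr2 {1}/cnt mulr_suml.
    rewrite exchange_big /=; apply: eq_bigr => x _.
    rewrite (bigD1 x) //= eqxx mul1r big1 ?addr0 // => g /negPf; rewrite eq_sym => ->.
    by rewrite mul0r.
  apply: ler_sum => x _; rewrite natr_sum /cnt; apply: ler_sum => y _.
  by rewrite eq_sym.
- exact: sum_sl2_correl.
Qed.

Lemma correl_prods1_pow i :
  correl_prods 1 ^+ (2 * 2 ^ i) <=
  (count_mem onem (P (2 * 2 ^ i)))%:R * (2 * q ^+ 2 * nf ^+ (2 * 2 ^ i)).
Proof.
have [/eqP e0|nf_gt0] := boolP (nf == 0).
  have f0 v : f v = 0.
    have /psumr_eq0P h : forall v, true -> 0 <= f v ^+ 2 by move=> ? _; exact: sqr_ge0.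
    by have /eqP := h e0 v isT; rewrite sqrf_eq0 => /eqP.
  rewrite correl_prods1 big1; last first.
    by move=> v _; rewrite big1 ?expr0n // => a _; rewrite f0.
  by rewrite expr0n muln_eq0 expn_eq0 /= mulr_ge0 // mulr_ge0 ?exprn_ge0 ?nf_ge0 // mulr_ge0 ?exprn_ge0.
have nfp : 0 < nf ^+ 2 by rewrite exprn_gt0 // lt_def nf_gt0 nf_ge0.
rewrite -(ler_pM2r nfp).
have -> : correl_prods 1 ^+ (2 * 2 ^ i) * nf ^+ 2 = (correl_prods 1 ^+ (2 ^ i) * nf) ^+ 2.
  by rewrite exprMn -exprM mulnC.
apply: (le_trans (y := (correl_prods (2 ^ i) * nf ^+ (2 ^ i)) ^+ 2)).
  have h := correl_prods_pow i.
  have h0 : 0 <= correl_prods 1 ^+ (2 ^ i) * nf.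
    by rewrite mulr_ge0 ?nf_ge0 // exprn_ge0 // correl_prods_ge0.
  by rewrite lerXn2r ?nnegrE // (le_trans h0 h).
rewrite exprMn -exprM [(2 ^ i * 2)%N]mulnC.
have := correl_prods_collisions (2 ^ i); rewrite addnn -mul2n => h.
have h1 : 0 <= nf ^+ (2 * 2 ^ i) by rewrite exprn_ge0 // nf_ge0.
apply: le_trans (ler_wpM2r h1 h) _.
by rewrite le_eqVlt; apply/orP; left; apply/eqP; ring.
Qed.
End Mixing.

(** * Sets that no matrix of the family connects *)

Section Avoid.
Variables (F : finFieldType) (A : seq (mat F)) (X Y : {set vec F}).
Local Notation q := #|F|.
Hypothesis detA : all (fun a => detm a == 1) A.
Hypothesis Y_hom : forall l v, l != 0 -> (scalev l v \in Y) = (v \in Y).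
Hypothesis X_0 : 0 \notin X.
Hypothesis Y_0 : 0 \notin Y.
Hypothesis avoid : forall a v, a \in A -> v \in X -> mulv a v \notin Y.

(* Apply the mixing bound to [f], the projection of the indicator of [Y] orthogonal to the constants. *)
Lemma avoid_bound i :
  ((size A ^ 2 * #|X| * #|Y|) ^ (2 * 2 ^ i) <=
   2 * q ^ 2 * count_mem onem (prods (quotients A) (2 * 2 ^ i)) * (q ^ 2 - 1) ^ (4 * 2 ^ i))%N.
Proof.
have [X0|X0] := posnP #|X|.
  by rewrite X0 muln0 mul0n exp0n // muln_gt0 expn_gt0.
have [Y0|Y0] := posnP #|Y|.
  by rewrite Y0 muln0 exp0n // muln_gt0 expn_gt0.
have q1 : (1 < q)%N := card_finNzRing_gt1 F.
pose K := (q ^ 2 - 1)%N.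
have K0 : (0 < K)%N by rewrite subn_gt0 -(exp1n 2) ltn_exp2r.
have cardV : #|{: vec F}| = K.+1 by rewrite card_prod -subSn ?subn1 //= ?mulnn // expn_gt0 ltnW.
pose y : rat := #|Y|%:R / K%:R.
(* The density [y] is subtracted only away from 0, which keeps [f 0 = 0]. *)
pose f (v : vec F) : rat := (v \in Y)%:R - y * (v != 0)%:R.
have Kn : (K%:R : rat) != 0 by rewrite pnatr_eq0 -lt0n.
have sumY : \sum_v ((v \in Y)%:R : rat) = #|Y|%:R.
  by rewrite -natr_sum -big_mkcond /= sum1_card.
have sumn0 : \sum_(v : vec F) ((v != 0)%:R : rat) = K%:R.
  by rewrite -natr_sum -big_mkcond /= sum1_card cardC1 cardV.
have f_hom l v : l != 0 -> f (scalev l v) = f v.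
  move=> ln; rewrite /f Y_hom //; congr (_ - _ * (~~ _)%:R).
  by case: v => a b; rewrite /scalev /= -!pair_eqE /= !mulf_eq0 (negPf ln).
have f_0 : f 0 = 0 by rewrite /f (negPf Y_0) eqxx mulr0 subr0.
have f_sum : \sum_v f v = 0.
  by rewrite sumrB -mulr_sumr sumY sumn0 divfK // subrr.
have y0 : 0 <= y by rewrite divr_ge0.
have nfE : \sum_v f v ^+ 2 <= #|Y|%:R.
  have -> : \sum_v f v ^+ 2 = \sum_v f v * (v \in Y)%:R.
    apply/eqP; rewrite -subr_eq0 -sumrB; apply/eqP.
    transitivity (\sum_v (- y) * f v); last by rewrite -mulr_sumr f_sum mulr0.
    apply: eq_bigr => v _; rewrite /f.
    case: (eqVneq v 0) => [->|_]; first by rewrite (negPf Y_0) /=; ring.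
    by rewrite /=; ring.
  rewrite -sumY; apply: ler_sum => v _; rewrite /f; case: (v \in Y) => /=; last by rewrite mulr0.
  by rewrite mulr1 gerBl mulr_ge0.
have big := correl_prods1_pow f_hom f_0 f_sum detA i.
(* Every translate of [f] equals - y on [X]. Pairing the sum of the translates with the indicator of
   [X] therefore bounds its norm from below. *)
have lower : (size A ^ 2 * #|X| * #|Y| ^ 2)%:R / K%:R ^+ 2 <= correl_prods f A 1.
  have s : \sum_v (\sum_(a <- A) f (mulv a v)) * (v \in X)%:R = - ((size A * #|X|)%:R * y).
    transitivity (\sum_v - ((size A)%:R * y) * (v \in X)%:R).
      apply: eq_bigr => v _; case hv: (v \in X); last by rewrite !mulr0.
      rewrite !mulr1 big_seq (eq_bigr (fun=> - y)).
        by rewrite -big_seq big_const_seq count_predT iter_addr addr0 mulNrn mulr_natl.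
      move=> a ha; rewrite /f (negPf (avoid ha hv)) sub0r.
      case: (eqVneq (mulv a v) 0) => [e|_]; last by rewrite mulr1.
      have v0 : v = 0 by rewrite -(adjKv v (eqP (allP detA _ ha))) e /mulv /= !mulr0 addr0.
      by move: hv; rewrite v0 (negPf X_0).
    by rewrite -mulr_sumr -natr_sum -big_mkcond /= sum1_card natrM; ring.
  have := cauchy_schwarz xpredT (fun v => \sum_(a <- A) f (mulv a v)) (fun v => (v \in X)%:R).
  rewrite s -correl_prods1 //.
  have -> : \sum_v ((v \in X)%:R : rat) ^+ 2 = #|X|%:R.
    under eq_bigr do rewrite -natrX expnS expn1 mulnb andbb.
    by rewrite -natr_sum -big_mkcond /= sum1_card.
  move=> h; have Xp : (0 : rat) < #|X|%:R by rewrite ltr0n.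
  rewrite -(ler_pM2r Xp); apply: le_trans h.
  by rewrite le_eqVlt; apply/orP; left; apply/eqP; rewrite /y !natrM; field.
set c := count_mem _ _ in big *.
set n := (2 * 2 ^ i)%N in big *.
have Kp : (0 : rat) < K%:R by rewrite ltr0n.
have Yp : (0 : rat) < #|Y|%:R by rewrite ltr0n.
have l2 : ((size A ^ 2 * #|X| * #|Y| ^ 2)%:R / K%:R ^+ 2) ^+ n <= c%:R * (2 * q%:R ^+ 2 * #|Y|%:R ^+ n) :> rat.
  apply: le_trans (le_trans _ big) _.
    rewrite lerXn2r ?nnegrE ?(le_trans _ lower) //.
      by rewrite divr_ge0 // exprn_ge0.
    by rewrite divr_ge0 // exprn_ge0.
  rewrite !ler_wpM2l ?mulr_ge0 ?exprn_ge0 //.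
  by rewrite lerXn2r ?nnegrE // nf_ge0.
rewrite -(ler_nat rat) !natrM !natrX.
rewrite -(ler_pM2r (exprn_gt0 n Yp)).
move: l2; rewrite expr_div_n ler_pdivrMr ?exprn_gt0 // -exprM.
rewrite (_ : (2 * n = 4 * 2 ^ i)%N); last by rewrite /n mulnA.
move=> l2; apply: (le_trans _ (le_trans l2 _)).
  by rewrite le_eqVlt; apply/orP; left; apply/eqP; rewrite -exprMn ?natrM ?natrX; congr (_ ^+ _); ring.
by rewrite le_eqVlt; apply/orP; left; apply/eqP; rewrite /K; ring.
Qed.
End Avoid.

(** * Contraction by unimodular matrices *)

Definition harmonic n : rat := \sum_(i < n) (i.+1%:R)^-1.

Lemma harmonicS n : harmonic n.+1 = harmonic n + n.+1%:R^-1.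
Proof. by rewrite /harmonic big_ord_recr. Qed.

Lemma harmonic_mono m n : (m <= n)%N -> harmonic m <= harmonic n.
Proof.
move=> /subnK <-; elim: (n - m)%N => // k IH; rewrite addSn harmonicS.
by apply: (le_trans IH); rewrite lerDl invr_ge0.
Qed.

(** Doubling n adds n terms, each at most 1/(n + 1), hence at most 1 in total. *)
Lemma harmonic_pow2 k : harmonic (2 ^ k) <= k.+1%:R.
Proof.
elim: k => [|k IH]; first by rewrite expn0 harmonicS /harmonic big_ord0 add0r invr1.
have step n m : harmonic (n + m) <= harmonic n + m%:R / n.+1%:R.
  elim: m => [|m IHm]; first by rewrite addn0 mul0r addr0.
  rewrite addnS harmonicS -[m.+1%:R]natr1 mulrDl mul1r addrA; apply: lerD => //.
  by rewrite lef_pV2 ?posrE ?ltr0n // ler_nat ltnS leq_addr.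
rewrite expnS mul2n -addnn; apply: le_trans (step _ _) _.
rewrite -[k.+2%:R]natr1; apply: lerD => //.
by rewrite ler_pdivrMr ?ltr0n // mul1r ler_nat leqW.
Qed.

Lemma harmonic_le k n : (n <= 2 ^ k)%N -> harmonic n <= k.+1%:R.
Proof. by move=> /harmonic_mono h; apply: le_trans h (harmonic_pow2 k). Qed.

Lemma seq_argmax (T : eqType) (w : T -> nat) (s : seq T) : s != [::] ->
  exists2 x, x \in s & forall y, y \in s -> (w y <= w x)%N.
Proof.
elim: s => // a s IH _; case: (eqVneq s [::]) => [->|/IH [x xs hx]].
  by exists a; rewrite ?inE // => y; rewrite inE => /eqP ->.
have [h|h] := leqP (w a) (w x).
  by exists x; rewrite ?inE ?xs ?orbT // => y; rewrite inE => /predU1P[->|/hx].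
exists a; rewrite ?inE ?eqxx // => y; rewrite inE => /predU1P[->|/hx hy] //.
by rewrite (leq_trans hy) // ltnW.
Qed.

(* The [k]-th smallest weight is at least [k / D]. *)
Lemma sum_inv_le_harmonic (T : eqType) (w : T -> nat) (s : seq T) (D : rat) :
  (forall x, x \in s -> (0 < w x)%N) ->
  (forall m, (0 < m)%N -> (count (fun x => w x <= m)%N s)%:R <= D * m%:R) ->
  \sum_(x <- s) (w x)%:R^-1 <= D * harmonic (size s).
Proof.
move en: (size s) => n; elim: n s en => [|n IH] s sn wpos hD.
  by rewrite (size0nil sn) big_nil /harmonic big_ord0 mulr0.
have [x xs hx] : exists2 x, x \in s & forall y, y \in s -> (w y <= w x)%N.
  by apply: seq_argmax; case: s sn {wpos hD}.
rewrite (perm_big _ (perm_to_rem xs)) big_cons harmonicS mulrDr addrC.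
apply: lerD; last first.
  apply: IH; first by rewrite size_rem // sn.
    by move=> y /mem_rem /wpos.
  move=> m m0; apply: le_trans (hD m m0); rewrite ler_nat.
  by rewrite (permP (perm_to_rem xs)) /= leq_addl.
have := hD _ (wpos _ xs).
rewrite (_ : count _ s = n.+1); last first.
  by rewrite -sn; apply/eqP; rewrite -all_count; apply/allP.
move=> h; have wx : (0 : rat) < (w x)%:R by rewrite ltr0n wpos.
by rewrite ler_pdivlMr ?ltr0n // mulrC ler_pdivrMr.
Qed.

Definition nrm (v : vec int) : nat := maxn `|v.1| `|v.2|.
Definition mnrm (g : mat int) : nat := maxn (nrm g.1) (nrm g.2).

Lemma nrm_gt0 v : (0 < nrm v)%N = (v != 0).
Proof. by case: v => a b; rewrite -pair_eqE /nrm /=; lia. Qed.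

Lemma mnrm_adj g : mnrm (adjm g) = mnrm g.
Proof. by rewrite /mnrm /nrm /=; lia. Qed.

Lemma mnrm1 : mnrm onem = 1%N.
Proof. by []. Qed.

Lemma mnrm_gt0 g : detm g = 1 -> (0 < mnrm g)%N.
Proof.
move=> dg; rewrite lt0n; apply/eqP => g0.
move: dg; case: g g0 => [[a b] [c d]]; rewrite /mnrm /nrm /detm /= => g0.
have [-> ->] : a = 0 /\ b = 0 by lia.
by rewrite !mul0r subr0 => /eqP.
Qed.

Lemma abszD2_le (x y z t : int) (n m : nat) :
  (`|x| <= n)%N -> (`|y| <= m)%N -> (`|z| <= n)%N -> (`|t| <= m)%N ->
  (`|(x * y + z * t)%R| <= 2 * (n * m))%N.
Proof.
move=> hx hy hz ht; have h : (`|(x * y + z * t)%R| <= `|(x * y)%R| + `|(z * t)%R|)%N by lia.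
by apply: (leq_trans h); rewrite !abszM mul2n -addnn leq_add ?leq_mul.
Qed.

Lemma nrm_mulv g v N M : (mnrm g <= N)%N -> (nrm v <= M)%N -> (nrm (mulv g v) <= 2 * (N * M))%N.
Proof.
case: g v => [[a b] [c d]] [x y]; rewrite /mnrm /nrm /= !geq_max.
move=> /andP[/andP[ha hb] /andP[hc hd]] /andP[hx hy].
by rewrite !abszD2_le.
Qed.

Lemma mnrm_mulm g h N M : (mnrm g <= N)%N -> (mnrm h <= M)%N -> (mnrm (mulm g h) <= 2 * (N * M))%N.
Proof.
case: g h => [[a b] [c d]] [[x y] [z t]]; rewrite /mnrm /nrm /= !geq_max.
move=> /andP[/andP[ha hb] /andP[hc hd]] /andP[/andP[hx hy] /andP[hz ht]].
by rewrite !abszD2_le.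
Qed.

(** Two numbers of the same sign in [-|X|, |X|] differ by less than |X|, unless one is 0 and the
    other extremal; the last hypothesis excludes that case. *)
Lemma bucket_shift (X x y k : int) : X != 0 -> (`|x| <= `|X|)%N -> (`|y| <= `|X|)%N ->
  y - x = k * X -> (x < 0) = (y < 0) -> (`|x|%N == `|X|%N) = (`|y|%N == `|X|%N) -> k = 0.
Proof.
move=> X0 hx hy e h1 h2; apply/eqP; apply/negPn/negP => kn.
have d : (`|X| <= `|(k * X)%R|)%N by rewrite abszM leq_pmull // absz_gt0.
by rewrite -e in d; case: (ltP x 0) (ltP y 0) h1 => hx0 [] hy0 // _; clear e kn; lia.
Qed.

(* Two vectors [s] with [nrm s <= nrm r] and the same [detv r s] differ by a multiple of the primitive
   vector [r]; the sign and the extremality of the dominant coordinate single one of them out. *)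
Definition bucket (r s : vec int) : bool * bool :=
  let X := if (`|r.2| <= `|r.1|)%N then r.1 else r.2 in
  let x := if (`|r.2| <= `|r.1|)%N then s.1 else s.2 in
  (x < 0, `|x|%N == `|X|%N).

Lemma bucket_inj (r u s s' : vec int) : (detv r u == 1) || (detv r u == -1) ->
  (nrm s <= nrm r)%N -> (nrm s' <= nrm r)%N -> detv r s = detv r s' ->
  bucket r s = bucket r s' -> s = s'.
Proof.
case: r u s s' => [r1 r2] [u1 u2] [s1 s2] [t1 t2]; rewrite /detv /nrm /bucket /= => du hs ht e hb.
(* Equal determinants against [r] make the difference parallel to [r]; it is an integer multiple
   because [r] and [u] form a basis of the lattice. *)
have [k [e1 e2]] : exists k : int, t1 - s1 = k * r1 /\ t2 - s2 = k * r2.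
  have e0 : r1 * (t2 - s2) = r2 * (t1 - s1) by lia.
  pose w := r1 * u2 - r2 * u1; pose k := (t1 - s1) * u2 - (t2 - s2) * u1.
  have h1 : (t1 - s1) * w = k * r1.
    apply: subr0_eq; transitivity (u1 * (r1 * (t2 - s2) - r2 * (t1 - s1))); first by rewrite /w /k; ring.
    by rewrite e0 subrr mulr0.
  have h2 : (t2 - s2) * w = k * r2.
    apply: subr0_eq; transitivity (u2 * (r1 * (t2 - s2) - r2 * (t1 - s1))); first by rewrite /w /k; ring.
    by rewrite e0 subrr mulr0.
  move: h1 h2; rewrite -/w in du; case/orP: du => /eqP ->; rewrite ?mulr1 ?mulrN1 => h1 h2.
    by exists k.
  by exists (- k); rewrite !mulNr -h1 -h2 !opprK.
have k0 : k = 0.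
  have rn : (r1 != 0) || (r2 != 0).
    by apply/negPn/negP; rewrite negb_or !negbK => /andP[/eqP a0 /eqP b0]; move: du; rewrite a0 b0 !mul0r.
  move: hs ht hb; rewrite !geq_max; case: (leqP `|r2|%N `|r1|%N) => h /andP[hs1 hs2] /andP[ht1 ht2] [h1 h2].
    by apply: (bucket_shift _ hs1 ht1 e1 h1 h2); lia.
  by apply: (bucket_shift _ hs2 ht2 e2 h1 h2); lia.
by move: e1 e2; rewrite k0 !mul0r => e1 e2; congr (_, _); lia.
Qed.

(** Cramer's rule: the coordinates of det(r, s) c are combinations of the two small pairings, with
    entries of [r] and [s] as coefficients. *)
Lemma detv_bound r s c N m : (nrm r <= N)%N -> (nrm s <= N)%N ->
  (`|(r.1 * c.1 + r.2 * c.2)%R| <= m)%N -> (`|(s.1 * c.1 + s.2 * c.2)%R| <= m)%N ->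
  (`|detv r s| * nrm c <= 2 * N * m)%N.
Proof.
case: r s c => [r1 r2] [s1 s2] [c1 c2]; rewrite /nrm /detv /= !geq_max.
set P := r1 * c1 + _; set Q := s1 * c1 + _.
move=> /andP[h1 h2] /andP[h3 h4] h5 h6.
have e1 : (r1 * s2 - r2 * s1) * c1 = s2 * P - r2 * Q by rewrite /P /Q; ring.
have e2 : (r1 * s2 - r2 * s1) * c2 = r1 * Q - s1 * P by rewrite /P /Q; ring.
rewrite /maxn; case: ifP => _; rewrite -abszM ?e1 ?e2 -mulnA -mulNr;
  rewrite abszD2_le //; rewrite ?abszN //.
Qed.

Lemma shift_ord_lt (z : int) (M : nat) : (`|z| <= M)%N -> (`|(z + M%:Z)%R| < (2 * M).+1)%N.
Proof. lia. Qed.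

Lemma shift_inj (z w : int) (M : nat) : (`|z| <= M)%N -> (`|w| <= M)%N ->
  `|(z + M%:Z)%R|%N = `|(w + M%:Z)%R|%N -> z = w.
Proof. lia. Qed.

Section Count.
Variables (A : seq (mat int)) (N : nat).
Hypothesis uA : uniq A.
Hypothesis detA : forall a, a \in A -> detm a = 1.
Hypothesis nrmA : forall a, a \in A -> (mnrm a <= N)%N.

(* The rows of the matrices counted lie in a strip orthogonal to [c]. Any two of them have determinant
   [O(N m / nrm c)], so the larger row of a matrix is determined, up to boundedly many choices, by its
   determinant against the longest row, and the smaller row is then determined by the larger one. *)
Lemma count_contract (c : vec int) (m : nat) : (0 < nrm c)%N ->
  (count (fun a => nrm (mulv a c) <= m)%N A * nrm c <= 192 * N * m)%N.
Proof.
move=> c0; rewrite -size_filter; set F := filter _ A.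
have [F0|Fn] := eqVneq F [::]; first by rewrite F0.
have hF a : a \in F -> [/\ a \in A, detm a = 1, (mnrm a <= N)%N & (nrm (mulv a c) <= m)%N].
  by rewrite mem_filter => /andP[h aA]; split; rewrite ?detA ?nrmA.
(* The inverse of a matrix of the list also has norm at most [N]. This bound later absorbs the 1 in
   [(2 * M).+1]. *)
have cNm : (nrm c <= 2 * N * m)%N.
  case: F Fn hF => // a F' _ /(_ a (mem_head _ _)) [_ da na ma].
  by rewrite -(adjKv c da) -mulnA nrm_mulv ?mnrm_adj.
pose rows := map fst F ++ map snd F.
have hrows r : r \in rows -> [/\ (nrm r <= N)%N, (`|(r.1 * c.1 + r.2 * c.2)%R| <= m)%N &
    exists u, (detv r u == 1) || (detv r u == -1)].
  rewrite mem_cat => /orP[] /mapP[a /hF[_ da na ma] ->]; move: na ma; rewrite /mnrm /nrm !geq_max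
    => /andP[/andP[h1 h2] /andP[h3 h4]] /andP[h5 h6]; split; rewrite ?geq_max ?h1 ?h2 ?h3 ?h4 //.
    by exists a.2; rewrite -da eqxx.
  by exists a.1; apply/orP; right; rewrite -da /detv /detm; apply/eqP; ring.
have [r0 r0in r0max] : exists2 x, x \in rows & forall y, y \in rows -> (nrm y <= nrm x)%N.
  by apply: seq_argmax; rewrite /rows; case: (F) Fn.
have [nr0 cr0 [u0 du0]] := hrows _ r0in.
have row1 a : a \in F -> a.1 \in rows by move=> h; rewrite mem_cat map_f.
have row2 a : a \in F -> a.2 \in rows by move=> h; rewrite mem_cat map_f ?orbT.
pose M := ((2 * N * m) %/ nrm c)%N.
pose big (a : mat int) := if (nrm a.2 <= nrm a.1)%N then a.1 else a.2.
pose small (a : mat int) := if (nrm a.2 <= nrm a.1)%N then a.2 else a.1.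
have big_row a : a \in F -> big a \in rows by rewrite /big => h; case: ifP; rewrite ?row1 ?row2.
have detM a : a \in F -> (`|detv r0 (big a)| <= M)%N.
  move=> /big_row /hrows [nb cb _]; rewrite leq_divRL //.
  exact: detv_bound.
pose code (a : mat int) := ((nrm a.2 <= nrm a.1)%N,
  inord `|(detv r0 (big a) + M%:Z)%R|%N : 'I_(2 * M).+1, bucket r0 (big a), bucket (big a) (small a)).
have code_inj : {in F &, injective code}.
  move=> a b ha hb e.
  have e1 := congr1 (fun z => z.1.1.1) e; have e2 := congr1 (fun z => z.1.1.2) e.
  have e3 := congr1 (fun z => z.1.2) e; have e4 := congr1 snd e; rewrite /= in e1 e2 e3 e4.
  have e2' : detv r0 (big a) = detv r0 (big b).
    have := congr1 val e2; rewrite /= !inordK ?shift_ord_lt ?detM //.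
    exact: shift_inj (detM _ ha) (detM _ hb).
  have eb : big a = big b by apply: (bucket_inj du0); rewrite ?r0max ?big_row.
  have [_ da _ _] := hF _ ha; have [_ db _ _] := hF _ hb.
  have es : small a = small b.
    apply: (@bucket_inj (big a) (small a)).
    - rewrite /big /small; case: ifP => _; first by rewrite -da eqxx.
      by apply/orP; right; rewrite -da /detv /detm; apply/eqP; ring.
    - by rewrite /big /small; case: ifP => // /negbT; rewrite -ltnNge => /ltnW.
    - by rewrite eb /big /small; case: ifP => // /negbT; rewrite -ltnNge => /ltnW.
    - rewrite {2}eb /big /small e1; case: ifP => _.
        by transitivity (detm a); [|rewrite da -db].
      apply: oppr_inj; transitivity (detm a); first by rewrite /detv /detm; ring.
      by rewrite da -db /detv /detm; ring.
    - by rewrite e4 eb.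
  by move: eb es; rewrite /big /small e1; case: ifP => _ eb es; rewrite [a]surjective_pairing [b]surjective_pairing eb es.
(* One bit for the longer row and two buckets of four values give 32; the final constant is 192 = 32
   (4 + 2). *)
have szF : (size F <= 32 * (2 * M).+1)%N.
  rewrite -(size_map code); have /card_uniqP <- : uniq (map code F).
    by rewrite map_inj_in_uniq; [exact: filter_uniq | exact: code_inj].
  apply: (leq_trans (max_card _)); by rewrite !card_prod !card_bool card_ord; clear; lia.
apply: (leq_trans (leq_mul szF (leqnn _))).
have hM : (M * nrm c <= 2 * N * m)%N by rewrite leq_trunc_div.
by clear -hM cNm; lia.
Qed.

Lemma sum_contract (c : vec int) h : (0 < nrm c)%N -> (size A <= 2 ^ h)%N ->
  \sum_(a <- A) (nrm (mulv a c))%:R^-1 <= (192 * N * h.+1)%:R / (nrm c)%:R :> rat.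
Proof.
move=> c0 hA; have cp : (0 : rat) < (nrm c)%:R by rewrite ltr0n.
have := count_contract _ c0; move: (192 * N)%N => K hK.
apply: le_trans (sum_inv_le_harmonic (D := K%:R / (nrm c)%:R) _ _) _.
- move=> a ha; rewrite nrm_gt0; apply: contraTneq c0 => e.
  by rewrite nrm_gt0 negbK -(adjKv c (detA ha)) e /mulv /= !mulr0 addr0.
- by move=> m m0; rewrite mulrAC ler_pdivlMr // -!natrM ler_nat hK.
rewrite mulrAC natrM; apply: ler_wpM2r; first by rewrite invr_ge0.
by apply: ler_wpM2l; [exact: ler0n | exact: harmonic_le].
Qed.
End Count.

(** * Products congruent to the identity *)

Lemma count_allpairs (S T U : eqType) (f : S -> T -> U) (a : pred U) s t :
  count a [seq f x y | x <- s, y <- t] = (\sum_(x <- s) count (fun y => a (f x y)) t)%N.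
Proof.
rewrite count_flatten sumnE !big_map; apply: eq_bigr => x _.
by rewrite count_map.
Qed.

(** A Schur test with weight 1/nrm. Below, [K] is [N] up to a logarithmic factor, although |A| is
    nearly N^2. *)
Definition contracting (A : seq (mat int)) (K : rat) : Prop :=
  forall c, (0 < nrm c)%N -> \sum_(a <- A) (nrm (mulv a c))%:R^-1 <= K / (nrm c)%:R.

Section Multiplicity.
Variables (K : rat).
Hypothesis K0 : 0 <= K.

Lemma mnrm_column (g : mat int) : exists2 c, nrm c = mnrm g &
  forall h, (nrm (mulv h c) <= mnrm (mulm h g))%N.
Proof.
have [e|e] := leqP (maxn `|g.1.2| `|g.2.2|) (maxn `|g.1.1| `|g.2.1|).
  exists (g.1.1, g.2.1).
    by rewrite /mnrm /nrm /= [RHS]maxnACA; apply/esym/maxn_idPl.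
  by move=> h; rewrite /mnrm /nrm /=; rewrite [leqRHS]maxnACA leq_maxl.
exists (g.1.2, g.2.2).
  by rewrite /mnrm /nrm /= [RHS]maxnACA; apply/esym/maxn_idPr/ltnW.
by move=> h; rewrite /mnrm /nrm /=; rewrite [leqRHS]maxnACA leq_maxr.
Qed.

(** Representations of g as b z are counted by the multiplicities of b^-1 g in [Z], and the
    contraction hypothesis sums their bounds over b. The longer column of g reduces norms of
    matrices to norms of vectors. *)
Lemma count_mulm (B Z : seq (mat int)) (k : rat) :
  0 <= k -> contracting (map (@adjm _) B) K -> (forall b, b \in B -> detm b = 1) ->
  (forall g, detm g = 1 -> (count_mem g Z)%:R <= k / (mnrm g)%:R) ->
  forall g, detm g = 1 ->
  (count_mem g [seq mulm b z | b <- B, z <- Z])%:R <= k * K / (mnrm g)%:R.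
Proof.
move=> k0 hB dB hZ g dg; rewrite count_allpairs natr_sum.
have [c nc hc] := mnrm_column g.
have c0 : (0 < nrm c)%N by rewrite nc mnrm_gt0.
apply: (le_trans (y := k * \sum_(b <- map (@adjm _) B) (nrm (mulv b c))%:R^-1)); last first.
  by rewrite -mulrA -nc; apply: ler_wpM2l => //; exact: hB.
rewrite big_map mulr_sumr big_seq [leRHS]big_seq; apply: ler_sum => b hb.
have db := dB _ hb.
rewrite (eq_count (a2 := pred1 (mulm (adjm b) g))); last first.
  move=> z /=; apply/eqP/eqP => [<-|->]; first by rewrite mulmA mul_adjm // mul1m.
  by rewrite mulmA mulm_adj // mul1m.
have dbg : detm (mulm (adjm b) g) = 1 by rewrite detmM detm_adj db dg mulr1.
apply: (le_trans (hZ _ dbg)); apply: ler_wpM2l => //.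
have bc0 : (0 < nrm (mulv (adjm b) c))%N.
  rewrite nrm_gt0; apply: contraTneq c0 => e.
  by rewrite nrm_gt0 negbK -(mulKv c db) e /mulv /= !mulr0 addr0.
rewrite lef_pV2 ?posrE ?ltr0n //; first by rewrite ler_nat.
exact: mnrm_gt0.
Qed.

(** A quotient is an element of [A] times an inverse of one, so each induction step applies
    [count_mulm] twice. *)
Lemma count_prods (A : seq (mat int)) :
  contracting A K -> contracting (map (@adjm _) A) K -> (forall a, a \in A -> detm a = 1) ->
  forall m g, detm g = 1 ->
  (count_mem g (prods (quotients A) m))%:R <= K ^+ (2 * m) / (mnrm g)%:R.
Proof.
move=> hA hA' dA; elim=> [|m IH] g dg.
  rewrite expr0 /= addn0; case: eqP => [<-|_]; first by rewrite mnrm1 divr1.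
  by rewrite divr_ge0.
pose Z := [seq mulm a x | a <- map (@adjm _) A, x <- prods (quotients A) m].
have hZ : forall g, detm g = 1 -> (count_mem g Z)%:R <= K ^+ (2 * m) * K / (mnrm g)%:R.
  apply: count_mulm; rewrite ?exprn_ge0 //.
    by rewrite -map_comp (eq_map (g := id)) ?map_id // => a; exact: adjmK.
  by move=> _ /mapP[a ha ->]; rewrite detm_adj dA.
have -> : K ^+ (2 * m.+1) = K ^+ (2 * m) * K * K by rewrite mulnS exprD expr2; ring.
suff -> : count_mem g (prods (quotients A) m.+1) = count_mem g [seq mulm b z | b <- A, z <- Z].
  by apply: count_mulm => //; rewrite mulr_ge0 // exprn_ge0.
rewrite /= !count_allpairs big_allpairs_dep exchange_big /=; apply: eq_bigr => b _.
rewrite count_allpairs big_map; apply: eq_bigr => a _.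
by apply: eq_count => x /=; rewrite mulmA.
Qed.
End Multiplicity.

Lemma mnrm_prods (A : seq (mat int)) N : (0 < N)%N -> (forall a, a \in A -> (mnrm a <= N)%N) ->
  forall m z, z \in prods (quotients A) m -> (mnrm z <= (2 * N) ^ (2 * m))%N.
Proof.
move=> N0 hA; elim=> [|m IH] z; first by rewrite inE => /eqP ->.
move=> /allpairsP[[e x] /= [/allpairsP[[a b] /= [ha hb ->]] hx ->]].
have h1 : (mnrm (mulm b (adjm a)) <= 2 * (N * N))%N by rewrite mnrm_mulm ?mnrm_adj ?hA.
apply: (leq_trans (mnrm_mulm h1 (IH _ hx))).
by rewrite mulnS expnD expnS expn1 !mulnA -![(2 * N * 2)%N]mulnA [(N * 2)%N]mulnC !mulnA.
Qed.

Lemma size_prods (R : comNzRingType) (A : seq (mat R)) m :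
  size (prods (quotients A) m) = (size A ^ (2 * m))%N.
Proof.
elim: m => [|m IH]; first by rewrite muln0.
by rewrite /= !size_allpairs IH mulnS expnD expnS expn1.
Qed.

Definition congr1m (p : nat) (g : mat int) : bool :=
  [&& (p%:Z %| g.1.1 - 1)%Z, (p%:Z %| g.1.2)%Z, (p%:Z %| g.2.1)%Z & (p%:Z %| g.2.2 - 1)%Z].

Lemma dvdz_bound (n : nat) (x : int) (M : nat) : (0 < n)%N -> (n%:Z %| x)%Z ->
  (`|x| <= M)%N -> (`|(x %/ n%:Z)%Z| <= M %/ n)%N.
Proof.
move=> n0 dx hx; rewrite leq_divRL //.
by rewrite -[X in (_ * X)%N](absz_nat n) -abszM divzK.
Qed.

Lemma dvdz_div_inj (n : nat) (x y : int) : (n%:Z %| x)%Z -> (n%:Z %| y)%Z ->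
  (x %/ n%:Z)%Z = (y %/ n%:Z)%Z -> x = y.
Proof. by move=> hx hy e; rewrite -(divzK hx) -(divzK hy) e. Qed.

Section Congruence.
Variables (p S tau : nat) (G : seq (mat int)).
Hypothesis p3 : (3 <= p)%N.
Hypothesis uG : uniq G.
Hypothesis hG : forall g, g \in G -> [/\ detm g = 1, congr1m p g, g != onem & (mnrm g <= S)%N].
Hypothesis htau : forall n, (0 < n)%N -> (n <= S ^ 2 + 1)%N -> (size (divisors n) <= tau)%N.

(* [det (1 + p h) = 1 + p tr h + p ^ 2 det h] gains a factor [p] over the obvious congruence. *)
Lemma trace_congr (g : mat int) : detm g = 1 -> congr1m p g ->
  ((p ^ 2)%N%:Z %| g.1.1 + g.2.2 - 2)%Z.
Proof.
case: g => [[a b] [c d]]; rewrite /detm /congr1m /= => e.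
move=> /and4P[/dvdzP[x ex] /dvdzP[y ey] /dvdzP[z ez] /dvdzP[t et]].
have -> : a + d - 2 = b * c - (a - 1) * (d - 1) by clear -e; lia.
apply/dvdzP; exists (y * z - x * t).
by rewrite ex ey ez et -mulnn PoszM; ring.
Qed.

Section CountCongr.
Variable m : nat.
Hypothesis mS : (m <= S)%N.
Local Notation U := ((2 * m + 2) %/ p ^ 2)%N.
Local Notation V := ((m + 1) %/ p)%N.
Local Notation F := [seq g <- G | (mnrm g <= m)%N].

Definition ubox (x : int) : 'I_(2 * U).+1 := inord `|(x + U%:Z)%R|%N.
Definition vbox (x : int) : 'I_(2 * V).+1 := inord `|(x + V%:Z)%R|%N.

(* The trace modulo [p ^ 2] and [a] modulo [p] leave few choices for the diagonal; then [b] is a divisor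
   of [a d - 1], except when [a d = 1], where one of [b], [c] vanishes. *)
Definition congr_code (g : mat int) :
    'I_(2 * U).+1 * 'I_(2 * V).+1 * (bool * 'I_tau.+1) + bool * 'I_(2 * V).+1 :=
  let: ((a, b), (c, d)) := g in
  if a * d == 1 then inr (b == 0, vbox ((if b == 0 then c else b) %/ p%:Z)%Z)
  else inl (ubox ((a + d - 2) %/ (p ^ 2)%N%:Z)%Z, vbox ((a - 1) %/ p%:Z)%Z,
            (b < 0, inord (index `|b|%N (divisors `|(a * d - 1)%R|)))).

Let p0 : (0 < p)%N. Proof. by apply: leq_trans p3. Qed.

Lemma vbox_inj (x y : int) : (p%:Z %| x)%Z -> (p%:Z %| y)%Z ->
  (`|x| <= m + 1)%N -> (`|y| <= m + 1)%N -> vbox (x %/ p%:Z)%Z = vbox (y %/ p%:Z)%Z -> x = y.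
Proof.
move=> dx dy hx hy e; apply: (dvdz_div_inj dx dy).
have bx := dvdz_bound p0 dx hx; have by' := dvdz_bound p0 dy hy.
apply: (shift_inj bx by'); move/(congr1 val): e; rewrite /vbox /= !inordK //; exact: shift_ord_lt.
Qed.

Lemma ubox_inj (x y : int) : ((p ^ 2)%N%:Z %| x)%Z -> ((p ^ 2)%N%:Z %| y)%Z ->
  (`|x| <= 2 * m + 2)%N -> (`|y| <= 2 * m + 2)%N ->
  ubox (x %/ (p ^ 2)%N%:Z)%Z = ubox (y %/ (p ^ 2)%N%:Z)%Z -> x = y.
Proof.
have p20 : (0 < p ^ 2)%N by rewrite expn_gt0 p0.
move=> dx dy hx hy e; apply: (dvdz_div_inj dx dy).
have bx := dvdz_bound p20 dx hx; have by' := dvdz_bound p20 dy hy.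
apply: (shift_inj bx by'); move/(congr1 val): e; rewrite /ubox /= !inordK //; exact: shift_ord_lt.
Qed.

(** Both factors are 1 or both are -1, and the latter would make [p] divide 2. *)
Lemma mul_eq1 (a d : int) : (p%:Z %| a - 1)%Z -> a * d = 1 -> a = 1 /\ d = 1.
Proof.
move=> /dvdzP[x ex] e; have : (`|a| * `|d| = 1)%N by rewrite -abszM e.
move/eqP; rewrite muln_eq1 => /andP[/eqP a1 /eqP d1].
have [a1'|a1'] : a = 1 \/ a = -1 by clear -a1; lia.
  by move: e; rewrite a1' mul1r.
have : (p %| 2)%N by apply/dvdnP; exists `|x|%N; rewrite -[p in RHS](absz_nat p) -abszM -ex a1'.
by move/dvdn_leq => /(_ isT); rewrite leqNgt p3.
Qed.

Lemma congr_code_inj : {in F &, injective congr_code}.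
Proof.
have hF g : g \in F -> [/\ detm g = 1, congr1m p g, (mnrm g <= m)%N & g \in G].
  by rewrite mem_filter => /andP[h gG]; have [? ? ? ?] := hG gG; split.
move=> g g' /hF[]; case: g g' => [[a b] [c d]] [[a' b'] [c' d']] dg cg ng gG /hF[dg' cg' ng' gG'].
have ta := trace_congr dg cg; have ta' := trace_congr dg' cg'.
move: cg cg' => /and4P[/= A1 A2 A3 A4] /and4P[/= B1 B2 B3 B4].
move: dg dg' ng ng' ta ta'; rewrite /detm /mnrm /nrm /= !geq_max.
move=> dg dg' /andP[/andP[na nb] /andP[nc nd]] /andP[/andP[na' nb'] /andP[nc' nd']] ta ta'.
have up (x : int) : (`|x| <= m)%N -> (`|x| <= m + 1)%N by rewrite addn1 => /leqW.
have up1 (x : int) : (`|x| <= m)%N -> (`|(x - 1)%R| <= m + 1)%N by clear; lia.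
have up2 (x y : int) : (`|x| <= m)%N -> (`|y| <= m)%N -> (`|(x + y - 2)%R| <= 2 * m + 2)%N by clear; lia.
rewrite /congr_code; case: (eqVneq (a * d) 1) => e; case: (eqVneq (a' * d') 1) => e' //.
  have [a1 d1] := mul_eq1 A1 e; have [a1' d1'] := mul_eq1 B1 e'.
  move: dg dg'; rewrite a1 d1 a1' d1' mul1r => dg dg'.
  have bc : b * c = 0 by clear -dg; lia.
  have bc' : b' * c' = 0 by clear -dg'; lia.
  case=> eb; rewrite -eb; case: (eqVneq b 0) eb => [b0 /esym/eqP b0'|nb0 /esym/negbT nb0'] ev.
    by rewrite b0 b0' (vbox_inj A3 B3 _ _ ev) ?up.
  have c0 : c = 0 by move/eqP: bc; rewrite mulf_eq0 (negPf nb0) => /eqP.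
  have c0' : c' = 0 by move/eqP: bc'; rewrite mulf_eq0 (negPf nb0') => /eqP.
  by rewrite c0 c0' (vbox_inj A2 B2 _ _ ev) ?up.
case=> eu ev es ei.
have ea : a = a' by have := vbox_inj A1 B1 (up1 _ na) (up1 _ na') ev; clear; lia.
have ed : d = d'.
  by have := ubox_inj ta ta' (up2 _ _ na nd) (up2 _ _ na' nd') eu; rewrite ea; clear; lia.
move: e e' ei dg dg' ta ta'; rewrite -ea -ed => e _ ei dg dg' _ _.
set n := `|(a * d - 1)%R|%N in ei.
have n0 : (0 < n)%N by rewrite absz_gt0 subr_eq0.
have nE : b * c = a * d - 1 by clear -dg; lia.
have nE' : b' * c' = a * d - 1 by clear -dg'; lia.
have nS : (n <= S ^ 2 + 1)%N.
  apply: (leq_trans (n := (`|a| * `|d| + 1)%N)); first by rewrite -abszM /n; clear; lia.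
  by rewrite leq_add2r -mulnn leq_mul // (leq_trans _ mS).
have db : `|b|%N \in divisors n by rewrite -dvdn_divisors // /n -nE abszM dvdn_mulr.
have db' : `|b'|%N \in divisors n by rewrite -dvdn_divisors // /n -nE' abszM dvdn_mulr.
have eb : `|b|%N = `|b'|%N.
  rewrite -(nth_index 0%N db) -(nth_index 0%N db'); congr nth.
  have hidx x : x \in divisors n -> (index x (divisors n) < tau.+1)%N.
    by rewrite -index_mem => h; rewrite ltnS ltnW // (leq_trans h) // htau.
  by move/(congr1 val): ei; rewrite /= !inordK ?hidx.
have bb : b = b' by clear -eb es; case: (ltP b 0) (ltP b' 0) es => h [] h' // _; lia.
have b0 : b != 0 by apply: contraNneq e => b0; rewrite -subr_eq0 -nE b0 mul0r.
have cc : c = c' by apply: (mulfI b0); rewrite nE -nE' bb.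
by rewrite cc bb.
Qed.

(** There are about tau (1 + m/p^2)(1 + m/p) codes. A nonempty list has p <= m + 1, so the constant
    terms can be absorbed into a multiple of m. *)
Lemma count_congr :
  (count (fun g => mnrm g <= m)%N G * p ^ 3 <= 96 * tau.+1 * (p ^ 2 + S) * m)%N.
Proof.
rewrite -size_filter; case: (eqVneq F [::]) => [->//|Fn].
(* A matrix congruent to 1 but different from it has an entry that differs from that of 1 by at
   least [p]. *)
have pm : (p <= m + 1)%N.
  have : exists g, g \in F by case: F Fn => // g s _; exists g; rewrite inE eqxx.
  case=> -[[a b] [c d]]; rewrite mem_filter => /andP[ng gG].
  have [_ /and4P[/= A1 A2 A3 A4] gn _] := hG gG.
  move: ng; rewrite /mnrm /nrm /= !geq_max => /andP[/andP[na nb] /andP[nc nd]].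
  have key (x : int) : (p%:Z %| x)%Z -> x != 0 -> (p <= `|x|)%N.
    by rewrite -absz_gt0 => h x0; apply: dvdn_leq.
  rewrite leqNgt; apply/negP => lt.
  have z (x : int) : (p%:Z %| x)%Z -> (`|x| <= m + 1)%N -> x = 0.
    by move=> dx hx; apply/eqP; apply: contraTT lt => /(key _ dx) h; rewrite -leqNgt (leq_trans h).
  have b0 : b = 0 by apply: z => //; rewrite (leq_trans nb) ?leq_addr.
  have c0 : c = 0 by apply: z => //; rewrite (leq_trans nc) ?leq_addr.
  have a0 : a - 1 = 0 by apply: z => //; clear -na; lia.
  have d0 : d - 1 = 0 by apply: z => //; clear -nd; lia.
  move/negP: gn; apply; apply/eqP.
  by rewrite b0 c0 -[a](subrK 1) -[d](subrK 1) a0 d0 !add0r.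
have szF : (size F <= (2 * U).+1 * (2 * V).+1 * (2 * tau.+1) + 2 * (2 * V).+1)%N.
  rewrite -(size_map congr_code); have /card_uniqP <- : uniq (map congr_code F).
    by rewrite map_inj_in_uniq; [exact: filter_uniq | exact: congr_code_inj].
  by apply: (leq_trans (max_card _)); rewrite card_sum !card_prod !card_bool !card_ord.
have hU : (U * p ^ 2 <= 2 * m + 2)%N := leq_trunc_div _ _.
have hV : (V * p <= m + 1)%N := leq_trunc_div _ _.
have m2 : (2 <= m)%N by clear -pm p3; lia.
have gV : ((2 * V).+1 * p <= 6 * m)%N by clear -hV pm m2; lia.
have gU : ((2 * U).+1 * p ^ 2 <= 8 * m + p ^ 2)%N by clear -hU m2; lia.
apply: (leq_trans (leq_mul szF (leqnn _))).
have -> : (((2 * U).+1 * (2 * V).+1 * (2 * tau.+1) + 2 * (2 * V).+1) * p ^ 3 =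
   ((2 * V).+1 * p) * (((2 * U).+1 * p ^ 2) * (2 * tau.+1) + 2 * p ^ 2))%N.
  by rewrite (_ : p ^ 3 = p * p ^ 2)%N ?expnS //; move: (p ^ 2)%N U V => *; ring.
apply: (leq_trans (leq_mul gV (leq_add (leq_mul gU (leqnn _)) (leqnn _)))).
move: mS; move: (p ^ 2)%N => P; clear; move=> mS.
have -> : (96 * tau.+1 * (P + S) * m = 6 * m * (16 * tau.+1 * (P + S)))%N by ring.
rewrite leq_mul2l; apply/orP; right.
apply: (leq_trans (n := ((8 * S + P) * (2 * tau.+1) + 2 * P)%N)).
  by rewrite leq_add2r leq_mul2r leq_add2r leq_mul2l mS !orbT.
have : (P <= P * tau.+1)%N by rewrite leq_pmulr.
by lia.
Qed.
End CountCongr.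

Lemma sum_congr : \sum_(g <- G) (mnrm g)%:R^-1 <=
  (96 * tau.+1 * (p ^ 2 + S))%:R / (p ^ 3)%:R * harmonic (size G).
Proof.
have p30 : (0 : rat) < (p ^ 3)%:R by rewrite ltr0n expn_gt0 (leq_trans _ p3).
have hc := count_congr; move: (96 * _ * _)%N hc => K hK.
apply: sum_inv_le_harmonic => [g /hG[dg _ _ _]|m m0]; first exact: mnrm_gt0.
rewrite mulrAC ler_pdivlMr // -!natrM ler_nat.
have [mS|Sm] := leqP m S; first exact: hK.
rewrite (eq_in_count (a2 := fun g => mnrm g <= S)%N); last first.
  by move=> g /hG[_ _ _ h]; rewrite h (leq_trans h) // ltnW.
by apply: leq_trans (hK _ (leqnn S)) _; rewrite leq_mul2l (ltnW Sm) orbT.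
Qed.
End Congruence.

Lemma count_sum_undup (T : eqType) (a : pred T) (s : seq T) :
  count a s = (\sum_(x <- undup s | a x) count_mem x s)%N.
Proof.
rewrite -(permP (perm_count_undup s)) count_flatten sumnE !big_map [RHS]big_mkcond.
by apply: eq_bigr => x _; rewrite count_nseq; case: (a x); rewrite ?mul1n.
Qed.

Lemma count_congr_prods (Z : seq (mat int)) (k : rat) (p S tau h : nat) :
  (3 <= p)%N -> 0 <= k ->
  (forall z, z \in Z -> detm z = 1) -> (forall z, z \in Z -> (mnrm z <= S)%N) ->
  (forall n, (0 < n)%N -> (n <= S ^ 2 + 1)%N -> (size (divisors n) <= tau)%N) ->
  (forall g, detm g = 1 -> (count_mem g Z)%:R <= k / (mnrm g)%:R) ->
  (size Z <= 2 ^ h)%N ->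
  (count (congr1m p) Z)%:R <=
    k * (1 + (96 * tau.+1 * (p ^ 2 + S) * h.+1)%:R / (p ^ 3)%:R).
Proof.
move=> p3 k0 dZ nZ htau hZ hh.
pose G := [seq g <- undup Z | congr1m p g && (g != onem)].
have hG g : g \in G -> [/\ detm g = 1, congr1m p g, g != onem & (mnrm g <= S)%N].
  by rewrite mem_filter mem_undup => /andP[/andP[-> ->] gZ]; rewrite dZ ?nZ.
have := sum_congr p3 (filter_uniq _ (undup_uniq Z)) hG htau.
have szG : (size G <= 2 ^ h)%N.
  by apply: leq_trans hh; rewrite size_filter (leq_trans (count_size _ _)) // size_undup.
have := harmonic_le szG; move: (96 * _ * _)%N => D hH hS.
rewrite count_sum_undup natr_sum.
(* The first [k] bounds the multiplicity of the identity, whose norm is 1. *)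
apply: (le_trans (y := k + k * \sum_(g <- G) (mnrm g)%:R^-1)); last first.
  rewrite mulrDr mulr1 lerD2l; apply: ler_wpM2l => //; apply: (le_trans hS).
  rewrite natrM mulrAC; apply: ler_wpM2r; first by rewrite invr_ge0.
  by apply: ler_wpM2l.
rewrite big_mkcond /= (bigID (fun g => g == onem)) /=; apply: lerD.
  apply: (le_trans (y := \sum_(g <- undup Z | g == onem) k)).
    apply: ler_sum => g /eqP ->; case: ifP => // _.
    by rewrite (le_trans (hZ _ (@detm1 _))) // mnrm1 divr1.
  rewrite big_const_seq iter_addr addr0 (eq_count (a2 := pred1 onem)) //.
  by rewrite count_uniq_mem ?undup_uniq //; case: (_ \in _); rewrite ?mulr0n ?mulr1n.
rewrite mulr_sumr big_filter -big_mkcondr /= [leRHS](eq_bigl (fun g => (g != onem) && congr1m p g)); last first.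
  by move=> g; rewrite andbC.
rewrite [leLHS]big_seq_cond [leRHS]big_seq_cond; apply: ler_sum => g /andP[]; rewrite mem_undup => gZ _.
by apply: hZ; exact: dZ.
Qed.

(** * Divisors and continued fraction words *)

Local Open Scope nat_scope.

(** For k > 0, e + 1 is at most k (e/k + 1) with e/k rounded down, hence at most k 2^(e/k); then
    take k-th powers. *)
Lemma expnS_le_exp2 k e : e.+1 ^ k <= k ^ k * 2 ^ e.
Proof.
case: k => [|k]; first by rewrite !expn0 mul1n expn_gt0.
set j := k.+1; have h : e.+1 <= j * 2 ^ (e %/ j).
  apply: (leq_trans (n := j * (e %/ j).+1)); first by rewrite mulnC ltn_ceil.
  by rewrite leq_mul2l ltn_expl.
apply: (leq_trans (n := (j * 2 ^ (e %/ j)) ^ j)); first by rewrite leq_exp2r.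
by rewrite expnMn -expnM leq_mul2l leq_exp2l // leq_trunc_div orbT.
Qed.

Lemma size_divisors n : size (divisors n) = \prod_(f <- prime_decomp n) f.2.+1.
Proof.
rewrite /divisors; elim: (prime_decomp n) => [|[p e] s IH]; first by rewrite big_nil.
rewrite big_cons -IH /=; move: (foldr _ _ _) => d.
elim: e => [|e IHe]; first by rewrite mul1n.
by rewrite iterS size_merge size_cat size_map IHe -mulSnr.
Qed.

(** A prime p >= 2^k satisfies (e + 1)^k <= p^e. Each of the fewer than 2^k smaller primes costs a
    factor [k ^ k]. *)
Lemma size_divisors_pow k n : 0 < n -> size (divisors n) ^ k <= (k ^ k) ^ (2 ^ k) * n.
Proof.
move=> n0; rewrite size_divisors (big_morph (fun x => x ^ k) (id1 := 1) (op1 := muln) (fun x y => expnMn x y k) (exp1n k)).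
pose c p := if p < 2 ^ k then k ^ k else 1.
have k0 : 0 < k ^ k by rewrite expn_gt0; case: posnP.
apply: (leq_trans (n := \prod_(f <- prime_decomp n) (c f.1 * f.1 ^ f.2))).
  rewrite big_seq [leqRHS]big_seq; apply: leq_prod => -[p e] /mem_prime_decomp[pr _ _] /=.
  rewrite /c; case: ltnP => [_|kp]; last first.
    rewrite mul1n; apply: (leq_trans (n := (2 ^ e) ^ k)).
      by case: (k) => // j; rewrite leq_exp2r // ltn_expl.
    by rewrite -expnM mulnC expnM; case: (e) => // j; rewrite leq_exp2r.
  apply: (leq_trans (expnS_le_exp2 k e)); rewrite leq_mul2l; apply/orP; right.
  by case: (e) => // j; rewrite leq_exp2r // prime_gt1.
rewrite big_split /= -prod_prime_decomp // leq_mul2r; apply/orP; right.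
have -> : \prod_(f <- prime_decomp n) c f.1 = \prod_(p <- primes n) c p by rewrite big_map.
rewrite -big_mkcond /= -big_filter big_const_seq iter_muln_1 leq_pexp2l //.
rewrite count_predT -[leqRHS](size_iota 0); apply: uniq_leq_size.
  by rewrite filter_uniq ?primes_uniq.
by move=> p; rewrite mem_filter mem_iota /= => /andP[].
Qed.

(** Taking for t the maximum of the divisor counts up to [M] gives one bound for all n, of order
    M^(1/k). *)
Lemma divisors_sup k : exists C, forall M, 0 < M -> exists2 t,
  (forall n, 0 < n -> n <= M -> size (divisors n) <= t) & t ^ k <= C * M.
Proof.
exists ((k ^ k) ^ (2 ^ k)); elim=> // M IH _; case: (posnP M) => [->|M0].
  exists (size (divisors 1)); first by move=> [|[|]] //.
  exact: size_divisors_pow.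
have [t ht tM] := IH M0.
exists (maxn t (size (divisors M.+1))).
  move=> n n0; rewrite leq_eqVlt => /predU1P[->|nM]; first by rewrite leq_maxr.
  by rewrite leq_max ht.
rewrite /maxn; case: ifP => _; first exact: size_divisors_pow.
by apply: (leq_trans tM); rewrite leq_mul2l leqnSn orbT.
Qed.

(** * Counting reduced fractions *)

Lemma leq_totient d : totient d <= d.
Proof.
rewrite totient_count_coprime; apply: (leq_trans (n := \sum_(0 <= i < d) 1)).
  by apply: leq_sum => i _; exact: leq_b1.
by rewrite sum_nat_const_nat subn0 muln1.
Qed.

(** With Q = 4 R, the sum of n up to Q is the sum of totient(d) times Q/d rounded down. The d <= R
    give at most R Q, half of the main term, and beyond R the quotient is at most 4. *)
Lemma sum_totient R : R ^ 2 <= \sum_(1 <= d < (4 * R).+1) totient d.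
Proof.
set Q := 4 * R.
have e : \sum_(1 <= n < Q.+1) n = \sum_(1 <= d < Q.+1) totient d * (Q %/ d).
  transitivity (\sum_(1 <= n < Q.+1) \sum_(1 <= d < Q.+1) (d %| n) * totient d).
    rewrite big_nat [RHS]big_nat; apply: eq_bigr => n /andP[n0 nQ].
    rewrite -[LHS](sum_totient_dvd n) -(big_mkord (fun d => d %| n) totient).
    rewrite big_ltn_cond // dvd0n eqn0Ngt n0 /=.
    have z : \sum_(n.+1 <= d < Q.+1) (d %| n) * totient d = 0.
      by rewrite big_nat big1 // => d /andP[nd _]; rewrite gtnNdvd.
    rewrite [RHS](big_cat_nat (n := n.+1)) //= z addn0 big_mkcond.
    by apply: eq_bigr => d _; case: (d %| n); rewrite ?mul1n.
  rewrite exchange_big_nat /=; apply: eq_bigr => d _.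
  by rewrite divn_count_dvd big_distrr /=; apply: eq_bigr => n _; rewrite mulnC.
have s : 2 * \sum_(1 <= n < Q.+1) n = Q * Q.+1.
  elim: (Q) => [|q IHq]; first by rewrite big_geq.
  by rewrite big_nat_recr //= mulnDr IHq; ring.
have up : \sum_(1 <= d < Q.+1) totient d * (Q %/ d) <= R * Q + 4 * \sum_(1 <= d < Q.+1) totient d.
  rewrite (big_cat_nat (n := R.+1)) //=; last by rewrite ltnS /Q leq_pmull.
  apply: leq_add.
    apply: (leq_trans (n := \sum_(1 <= d < R.+1) Q)); last by rewrite sum_nat_const_nat subn1.
    rewrite big_nat [leqRHS]big_nat; apply: leq_sum => d /andP[d0 _].
    by apply: (leq_trans _ (leq_trunc_div Q d)); rewrite mulnC leq_mul2l leq_totient orbT.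
  rewrite big_distrr /= [leqRHS](big_cat_nat (n := R.+1)) //=; last by rewrite ltnS /Q leq_pmull.
  apply: leq_trans (leq_addl _ _).
  rewrite big_nat [leqRHS]big_nat; apply: leq_sum => d /andP[Rd _].
  rewrite mulnC leq_mul2r; apply/orP; right.
  have d0 : 0 < d by apply: leq_ltn_trans Rd.
  by rewrite -ltnS ltn_divLR // /Q; clear -Rd; lia.
move: up; rewrite -e; move: s; rewrite /Q; nia.
Qed.

(* With [cfv w (0, 1) = (a, q)] the word [w] is the continued fraction expansion of [a / q]. *)
Definition cfv (w : seq nat) (v : nat * nat) : nat * nat :=
  foldr (fun b u => (u.2, b * u.2 + u.1)) v w.
Definition cfrac w := cfv w (0, 1).

Definition matw (w : seq nat) : mat int :=
  foldr (fun b g => mulm ((0, 1)%R, (1%R, Posz b)) g) onem w.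

Definition pos (w : seq nat) := all (fun b => 0 < b) w.

Lemma matwE w x y : mulv (matw w) (Posz x, Posz y) = (Posz (cfv w (x, y)).1, Posz (cfv w (x, y)).2).
Proof.
elim: w => [|b w IH]; first by rewrite mul1v.
by rewrite /= mulmv IH /mulv /= mul0r add0r !mul1r addrC PoszD PoszM.
Qed.

Lemma matw_cat u v : matw (u ++ v) = mulm (matw u) (matw v).
Proof. by elim: u => [|b u IH] /=; rewrite ?mul1m // IH mulmA. Qed.

Lemma detm_matw w : detm (matw w) = ((-1) ^+ size w)%R.
Proof. by elim: w => [|b w IH] /=; rewrite ?detm1 // detmM IH exprS /detm /=; ring. Qed.

Definition trm (g : mat int) : mat int := ((g.1.1, g.2.1), (g.1.2, g.2.2)).

(** The matrix of a letter is symmetric, so transposing a product reverses it. *)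
Lemma matw_rev w : matw (rev w) = trm (matw w).
Proof.
elim: w => [//|b w IH]; rewrite rev_cons -cats1 matw_cat IH /=.
by congr ((_, _), (_, _)) => /=; ring.
Qed.

(** A word may end in 1, so a = q occurs. The last bound, by which length is logarithmic in the
    denominator, holds because q (q + a) at least doubles with each letter. *)
Lemma cfrac_prop w : pos w -> let: (a, q) := cfrac w in
  [/\ 0 < q, a <= q, coprime a q, (a == 0) = (w == [::]) & 2 ^ size w <= q * (q + a)].
Proof.
rewrite /cfrac; elim: w => [//|b w IH] /= /andP[b0 /IH]; case: (cfv w (0, 1)) => a q /= [q0 aq cp e sz].
split.
- by rewrite addn_gt0 muln_gt0 b0 q0.
- by rewrite (leq_trans _ (leq_addr _ _)) // leq_pmull.
- by rewrite /coprime gcdnMDl -/(coprime q a) coprime_sym.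
- by rewrite eqn0Ngt q0.
rewrite expnS; apply: (leq_trans (leq_mul (leqnn 2) sz)).
by case: b b0 => // b _; nia.
Qed.

Lemma mnrm_matw w : pos w -> mnrm (matw w) <= (cfrac w).2.
Proof.
(* The fourth inequality is there for the induction: it yields the second one after a further
   letter. *)
move=> pw; have [h1 h2 h3 h4] : [/\ (cfv w (1, 0)).1 <= (cfv w (0, 1)).2,
    (cfv w (1, 0)).2 <= (cfv w (0, 1)).2, (cfv w (0, 1)).1 <= (cfv w (0, 1)).2 &
    (cfv w (1, 0)).1 + (cfv w (1, 0)).2 <= (cfv w (0, 1)).2 + (cfv w (0, 1)).1].
  elim: w pw => [//|b w IH] /= /andP[b0 /IH].
  case: (cfv w (1, 0)) => x y; case: (cfv w (0, 1)) => a q /= [h1 h2 h3 h4].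
  by case: b b0 => // b _; clear -h1 h2 h3 h4; split; nia.
have e1 := matwE w 1 0; have e2 := matwE w 0 1; move: h1 h2 h3 {h4} e1 e2; rewrite /cfrac.
case: (matw w) => [[a b] [c d]]; rewrite /mnrm /nrm /mulv /= !mulr0 !mulr1 !addr0 !add0r.
by move=> h1 h2 h3 [-> ->] [-> ->]; rewrite !geq_max !absz_nat h1 h2 h3 leqnn.
Qed.

(** Equal lengths rule out the ambiguity between a final letter b + 1 and the ending b, 1. *)
Lemma cfrac_inj w w' : pos w -> pos w' -> size w = size w' -> cfrac w = cfrac w' -> w = w'.
Proof.
elim: w w' => [|b w IH] [|b' w'] //= /andP[b0 pw] /andP[b0' pw'] [sz].
have := cfrac_prop pw; have := cfrac_prop pw'; move: (IH _ pw pw' sz); rewrite /cfrac /=.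
case: (cfv w _) => a q; case: (cfv w' _) => a' q' /= hI [q0' aq' _ e' _] [q0 aq _ e _] [eq1 eq2].
have ee : (a == 0) = (a' == 0) by rewrite e e' -!size_eq0 sz.
have eb : b = b'.
  subst q'; have [a0|a0] := posnP a.
    move: ee eq2; rewrite a0 eqxx => /esym/eqP ->; rewrite !addn0 => /eqP.
    by rewrite eqn_pmul2r // => /eqP.
  have a0' : 0 < a' by rewrite lt0n -ee -lt0n.
  clear -eq2 q0 aq aq' a0 a0'; nia.
by rewrite eb hI // eq1; move: eq2; rewrite eb eq1 => /addnI ->.
Qed.

Lemma cfrac_exists a q : a < q -> coprime a q ->
  exists w, [/\ pos w, all (fun b => b <= q) w & cfrac w = (a, q)].
Proof.
elim/ltn_ind: a q => a IH q aq cp; case: (posnP a) => [a0|a0].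
  by exists [::]; split=> //; move: cp; rewrite a0 /coprime gcd0n => /eqP ->.
have cp' : coprime (q %% a) a by rewrite coprime_sym coprime_modr.
have [w [pw lw ew]] := IH _ (ltn_pmod q a0) _ (ltn_pmod q a0) cp'.
exists (q %/ a :: w); split.
- by rewrite /= divn_gt0 // (ltnW aq) pw.
- by rewrite /= leq_div; apply: sub_all lw => b h; exact: leq_trans h (ltnW aq).
- by move: ew; rewrite /cfrac /= => ->; rewrite /= -divn_eq.
Qed.

Fixpoint words (n Q : nat) : seq (seq nat) :=
  if n is n'.+1 then [seq b :: w | b <- iota 1 Q, w <- words n' Q] else [:: [::]].

Lemma mem_words n Q w : (w \in words n Q) = (size w == n) && all (fun b => 0 < b <= Q) w.
Proof.
elim: n w => [|n IH] w; first by rewrite inE; case: w.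
apply/allpairsP/andP => [[[b u] /= [hb hu ->]]|[]].
  move: hb hu; rewrite mem_iota IH add1n ltnS /= => -> /andP[/eqP -> ->]; by rewrite eqxx.
case: w => // b u /=; rewrite eqSS => su /andP[hb hu].
by exists (b, u); rewrite mem_iota add1n ltnS IH su hb hu.
Qed.

Lemma uniq_words n Q : uniq (words n Q).
Proof.
elim: n => // n IH; apply: allpairs_uniq => //; first exact: iota_uniq.
by move=> [b w] [b' w'] _ _ [-> ->].
Qed.

(** The common length [s] makes concatenations of blocks uniquely decodable and [cfrac] injective on
    them. *)
Definition block_ok (s Q : nat) (W : seq (seq nat)) :=
  uniq W /\ forall w, w \in W -> [/\ size w = s, all (fun b => 0 < b <= Q) w & mnrm (matw w) <= Q].

Lemma pos_le Q w : all (fun b => 0 < b <= Q) w -> pos w.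
Proof. by apply: sub_all => b /andP[]. Qed.

(** By [sum_totient], at least 4^(e - 2) reduced fractions have denominator at most 2^e. Their words
    have fewer than 2 (e + 1) possible lengths, so one length is frequent. *)
Lemma blocks_pigeonhole e : 2 <= e -> exists s W, block_ok s (2 ^ e) W /\
  4 ^ (e - 2) <= size W * (2 * e.+1).
Proof.
move=> e2; set Q := 2 ^ e.
pose W s := [seq w <- words s Q | mnrm (matw w) <= Q].
have okW s : block_ok s Q (W s).
  split; first by rewrite filter_uniq ?uniq_words.
  by move=> w; rewrite mem_filter mem_words => /and3P[-> /eqP -> ->].
suff h : 4 ^ (e - 2) <= \sum_(s < 2 * e.+1) size (W s).
  have [s hs|none] := pickP (fun s : 'I_(2 * e.+1) => 4 ^ (e - 2) <= size (W s) * (2 * e.+1)).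
    by exists s, (W s).
  have lt (s : 'I_(2 * e.+1)) : size (W s) * (2 * e.+1) < 4 ^ (e - 2) by rewrite ltnNge none.
  have : (\sum_(s < 2 * e.+1) size (W s)) * (2 * e.+1) <= \sum_(s < 2 * e.+1) (4 ^ (e - 2)).-1.
    rewrite big_distrl /=; apply: leq_sum => s _; rewrite -ltnS prednK ?expn_gt0 //.
  rewrite sum_nat_const card_ord mulnC leq_pmul2l // => h'.
  by have := leq_trans h h'; rewrite -ltnS prednK ?expn_gt0 // ltnn.
pose pairs := [seq (a, q) | q <- iota 1 Q, a <- [seq a <- iota 0 q | coprime q a]].
have upairs : uniq pairs.
  apply: allpairs_uniq_dep => [|q _|]; rewrite ?filter_uniq ?iota_uniq //.
  by move=> [q a] [q' a'] _ _ /= [-> ->].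
have szp : 4 ^ (e - 2) <= size pairs.
  rewrite size_allpairs_dep sumnE big_map.
  have -> : iota 1 Q = index_iota 1 Q.+1 by rewrite /index_iota subSS subn0.
  have -> : \sum_(1 <= q < Q.+1) size [seq a <- iota 0 q | coprime q a] =
            \sum_(1 <= q < Q.+1) totient q.
    apply: eq_bigr => q _; rewrite totient_count_coprime size_filter -sum1_count big_mkcond.
    by rewrite /index_iota subn0; apply: eq_bigr => i _; case: coprime.
  have -> : Q = 4 * 2 ^ (e - 2) by rewrite -(expnD 2 2) subnKC.
  by apply: leq_trans (sum_totient _); rewrite -expnM mulnC expnM.
apply: (leq_trans szp).
have -> : \sum_(s < 2 * e.+1) size (W s) = size (map cfrac (flatten [seq W s | s <- iota 0 (2 * e.+1)])).
  rewrite size_map size_flatten sumnE !big_map -(big_mkord xpredT (fun s => size (W s))).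
  by rewrite /index_iota subn0.
apply: uniq_leq_size => // -[a q] /allpairsPdep[q' [a' [hq ha [-> ->]]]].
move: hq ha; rewrite mem_iota mem_filter mem_iota add1n ltnS add0n => /andP[q0 qQ] /and3P[cp _ aq].
have [w [pw lw ew]] := cfrac_exists aq (etrans (coprime_sym _ _) cp).
apply/mapP; exists w => //; apply/flatten_mapP; exists (size w).
  rewrite mem_iota /= add0n; have := cfrac_prop pw; rewrite ew => -[_ a'q _ _ sz].
  rewrite -(ltn_exp2l _ _ (isT : 1 < 2)); apply: (leq_ltn_trans sz).
  apply: (leq_ltn_trans (n := Q * (Q + Q))); first by rewrite leq_mul // leq_add // (leq_trans a'q).
  by rewrite addnn -mul2n mulnCA -expnD -expnS ltn_exp2l // addnn -mul2n; lia.
rewrite mem_filter mem_words eqxx /= (leq_trans (mnrm_matw pw)) ?ew //=.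
apply/allP => b hb; rewrite (allP pw _ hb) (leq_trans (allP lw _ hb)) //.
Qed.

(** With L = 2^(e + 1), twice the norm bound, this says |W| >= L^(2 - 1/D): the loss by pigeonhole
    is only logarithmic in L. *)
Lemma dense_blocks D : exists e s W, block_ok s (2 ^ e) W /\
  2 ^ (e.+1 * (2 * D - 1)) <= size W ^ D.
Proof.
(* Large enough for [key], by [expnS_le_exp2] with exponent [D.+1]. *)
pose e := (2 ^ (7 * D) * D.+1 ^ D.+1).+1.
have e2 : 2 <= e by rewrite /e ltnS muln_gt0 !expn_gt0.
have [s [W [okW hW]]] := blocks_pigeonhole e2.
exists e, s, W; split=> //.
have key : 2 ^ (7 * D) * e.+1 ^ D <= 2 ^ e.
  have C0 : 0 < D.+1 ^ D.+1 by rewrite expn_gt0.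
  rewrite -(leq_pmul2l C0); apply: leq_trans (expnS_le_exp2 D.+1 e).
  rewrite [e.+1 ^ D.+1]expnS mulnA leq_mul2r; apply/orP; right.
  by rewrite mulnC /e; apply: leqW; exact: leqnSn.
rewrite -(leq_pmul2r (m := (2 * e.+1) ^ D)); last by rewrite expn_gt0.
rewrite -expnMn; apply: (leq_trans (n := (4 ^ (e - 2)) ^ D)); last first.
  by case: (D) => // D'; rewrite leq_exp2r.
rewrite expnMn mulnA -expnD -(leq_pmul2l (m := 2 ^ (6 * D))); last by rewrite expn_gt0.
rewrite mulnA -expnD.
case: (posnP D) key => [->|D0] key; first by rewrite !(muln0, sub0n, expn0, addn0).
have -> : 6 * D + (e.+1 * (2 * D - 1) + D) = 7 * D + e.+1 * (2 * D - 1) by lia.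
rewrite expnD mulnAC; apply: (leq_trans (leq_mul key (leqnn _))).
rewrite -(expnM 2 2) -expnM -!expnD leq_exp2l // => {key}.
have [e' ->] : exists e', e = e' + 2 by exists (e - 2); rewrite subnK.
have [D' ->] : exists D', D = D'.+1 by exists D.-1; rewrite prednK.
by rewrite addnK; nia.
Qed.

(** * Reduction modulo p *)

Section Concat.
Variables (s Q : nat) (W : seq (seq nat)).
Hypothesis W_ok : block_ok s Q W.

(** Concatenation keeps the letters bounded by [Q] while size |W|^t and norm (2 Q)^t grow with the
    same exponent ratio, so one block set serves all scales. *)
Fixpoint concats (t : nat) : seq (seq nat) :=
  if t is t'.+1 then [seq u ++ v | u <- W, v <- concats t'] else [:: [::]].

Lemma size_concats t : size (concats t) = size W ^ t.
Proof. by elim: t => //= t IH; rewrite size_allpairs IH expnS. Qed.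

Lemma concatsP t w : w \in concats t ->
  [/\ size w = s * t, all (fun b => 0 < b <= Q) w & mnrm (matw w) <= (2 * Q) ^ t].
Proof.
elim: t w => [|t IH] w; first by rewrite inE => /eqP ->; rewrite muln0.
move=> /allpairsP[[u v] /= [/(proj2 W_ok) [su au nu] /IH[sv av nv] ->]].
rewrite size_cat su sv mulnS all_cat au av matw_cat expnS -mulnA; split=> //.
exact: mnrm_mulm.
Qed.

Lemma uniq_concats t : uniq (concats t).
Proof.
elim: t => //= t IH; apply: allpairs_uniq => //; first exact: (proj1 W_ok).
move=> _ _ /allpairsP[[u v] /= [hu hv ->]] /allpairsP[[u' v'] /= [hu' hv' ->]] /= /eqP.
have [su _ _] := (proj2 W_ok) _ hu; have [su' _ _] := (proj2 W_ok) _ hu'.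
by rewrite eqseq_cat ?su ?su' // => /andP[/eqP -> /eqP ->].
Qed.

Lemma concats_inj t : {in concats t &, injective cfrac}.
Proof.
move=> u v /concatsP[su /pos_le pu _] /concatsP[sv /pos_le pv _].
by apply: cfrac_inj => //; rewrite su sv.
Qed.

Lemma concats_matw_inj t : {in concats t &, injective matw}.
Proof.
move=> u v hu hv e; apply: (concats_inj hu hv).
have := matwE v 0 1; rewrite -e matwE => -[e1 e2].
by rewrite /cfrac [LHS]surjective_pairing [RHS]surjective_pairing e1 e2.
Qed.

Lemma cfrac_bound t w : w \in concats t ->
  let: (a, q) := cfrac w in [/\ 0 < q, a <= q, coprime a q & q <= (2 * Q) ^ t].
Proof.
move=> /concatsP[_ /pos_le pw nw]; have := cfrac_prop pw.
have := matwE w 0 1; rewrite -/(cfrac w); case: (cfrac w) => a q /= [_ e2] [q0 aq cp _ _].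
split=> //; apply: leq_trans nw; rewrite -(absz_nat q) -e2 mulr0 mulr1 add0r.
by rewrite /mnrm /nrm !leq_max leqnn !orbT.
Qed.
End Concat.

Section Reduction.
Variable p : nat.
Hypothesis pr : prime p.
Local Notation F := 'F_p.

Definition redv (v : vec int) : vec F := (v.1%:~R, v.2%:~R)%R.
Definition redm (g : mat int) : mat F := (redv g.1, redv g.2).

Lemma redm_mul g h : redm (mulm g h) = mulm (redm g) (redm h).
Proof. by congr ((_, _), (_, _)) => /=; rewrite rmorphD !rmorphM. Qed.
Lemma redm_adj g : redm (adjm g) = adjm (redm g).
Proof. by congr ((_, _), (_, _)) => /=; rewrite rmorphN. Qed.
Lemma redm1 : redm onem = onem.
Proof. by congr ((_, _), (_, _)). Qed.
Lemma redv_mul g v : redv (mulv g v) = mulv (redm g) (redv v).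
Proof. by congr (_, _) => /=; rewrite rmorphD !rmorphM. Qed.
Lemma detm_red g : detm (redm g) = ((detm g)%:~R)%R.
Proof. by rewrite /detm /= rmorphB !rmorphM. Qed.

Lemma intr_Fp_eq0 (x : int) : ((x%:~R : F) == 0)%R = (Posz p %| x)%Z.
Proof. by rewrite (dvdz_pcharf (pchar_Fp pr)). Qed.

Lemma redm_eq1 g : (redm g == onem) = congr1m p g.
Proof.
case: g => [[a b] [c d]]; rewrite /congr1m /= -!intr_Fp_eq0 !rmorphB /= !subr_eq0.
by rewrite -!pair_eqE /= -!pair_eqE /= -!andbA.
Qed.

Lemma map_quotients A : map redm (quotients A) = quotients (map redm A).
Proof.
rewrite /quotients map_allpairs allpairs_mapl allpairs_mapr.
by apply: eq_allpairs => a b /=; rewrite redm_mul redm_adj.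
Qed.

Lemma map_prods A m : map redm (prods (quotients A) m) = prods (quotients (map redm A)) m.
Proof.
elim: m => [|m IH]; first by rewrite /= redm1.
rewrite /= -IH -map_quotients map_allpairs allpairs_mapl allpairs_mapr.
by apply: eq_allpairs => a b /=; rewrite redm_mul.
Qed.

Lemma count_prods_red A m :
  count_mem onem (prods (quotients (map redm A)) m) = count (congr1m p) (prods (quotients A) m).
Proof. by rewrite -map_prods count_map; apply: eq_count => g /=; rewrite redm_eq1. Qed.

Lemma intr_Fp_inj (a b : nat) : a < p -> b < p -> ((Posz a)%:~R = (Posz b)%:~R :> F)%R -> a = b.
Proof.
move=> ha hb /eqP; rewrite -subr_eq0 -rmorphB /= intr_Fp_eq0 => d.
have [n0|] := posnP `|(Posz a - Posz b)%R|; first by clear -n0; lia.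
move=> /dvdn_leq /(_ d); clear -ha hb; lia.
Qed.
End Reduction.

Section Lines.
Variables (p : nat) (s Q : nat) (W : seq (seq nat)) (t : nat).
Hypothesis pr : prime p.
Hypothesis W_ok : block_ok s Q W.
Hypothesis Q0 : 0 < Q.
Hypothesis p_gt : (2 * Q) ^ (2 * t) < p.
Local Notation F := 'F_p.

Definition cvec (w : seq nat) : vec int := (Posz (cfrac w).1, Posz (cfrac w).2).
Definition line_seq : seq (vec F) :=
  [seq scalev l (redv p (cvec w)) | l <- enum (predC1 (0 : F)%R), w <- concats W t].
Definition line_set : {set vec F} := [set v in line_seq].
(* The lines orthogonal to those of [line_set]. *)
Definition rot_set : {set vec F} := [set v : vec F | (- v.2, v.1)%R \in line_set].

Lemma den_lt w : w \in concats W t -> (cfrac w).2 < p.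
Proof.
move=> /(cfrac_bound W_ok); case: (cfrac w) => a q /= [_ _ _ h].
apply: leq_ltn_trans p_gt; apply: (leq_trans h).
by rewrite leq_pexp2l ?muln_gt0 // leq_pmull.
Qed.

Lemma den_neq0 w : w \in concats W t -> ((redv p (cvec w)).2 != 0)%R.
Proof.
move=> hw; have := den_lt hw; have := cfrac_bound W_ok hw; rewrite /redv /=.
case: (cfrac w) => a q /= [q0 _ _ _] qp.
by rewrite intr_Fp_eq0 // dvdzE !absz_nat gtnNdvd.
Qed.

(** Both cross products are below [p], so their congruence is an equality of integers, and reduced
    fractions with equal cross products coincide. *)
Lemma cross_inj u v : u \in concats W t -> v \in concats W t ->
  (detv (redv p (cvec u)) (redv p (cvec v)) = 0)%R -> u = v.
Proof.
move=> hu hv; have := cfrac_bound W_ok hu; have := cfrac_bound W_ok hv.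
have := @concats_inj _ _ _ W_ok t _ _ hu hv; rewrite /detv /redv /cvec /=.
case: (cfrac u) (cfrac v) => [a q] [b r] /= hinj [r0 br cb hr] [q0 aq ca hq].
have E (x y : nat) : ((Posz x)%:~R * (Posz y)%:~R = (Posz (x * y))%:~R :> F)%R.
  by rewrite PoszM rmorphM.
move/eqP; rewrite subr_eq0 !E => /eqP.
have lt x y : x <= (2 * Q) ^ t -> y <= (2 * Q) ^ t -> x * y < p.
  by move=> hx hy; apply: leq_ltn_trans p_gt; rewrite [2 * t]mul2n -addnn expnD leq_mul.
move=> /intr_Fp_inj => /(_ pr (lt _ _ (leq_trans aq hq) hr) (lt _ _ hq (leq_trans br hr))) e.
have eq1 : q = r.
  apply/eqP; rewrite eqn_dvd.
  have -> : q %| r by rewrite -(Gauss_dvdr r (_ : coprime q a)) ?e ?dvdn_mulr // coprime_sym.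
  by rewrite -(Gauss_dvdr q (_ : coprime r b)) 1?mulnC -?e ?dvdn_mull // coprime_sym.
apply: hinj; congr (_, _) => //; apply/eqP.
by rewrite -(eqn_pmul2r r0) e eq1 mulnC.
Qed.

Lemma uniq_line_seq : uniq line_seq.
Proof.
apply: allpairs_uniq; rewrite ?enum_uniq ?(uniq_concats W_ok) //.
move=> _ _ /allpairsP[[l u] /= [hl hu ->]] /allpairsP[[m v] /= [hm hv ->]] e.
move: hl hm; rewrite !mem_enum !inE => hl hm.
have e1 : (l * (redv p (cvec u)).1 = m * (redv p (cvec v)).1)%R := congr1 fst e.
have e2 : (l * (redv p (cvec u)).2 = m * (redv p (cvec v)).2)%R := congr1 snd e.
have euv : u = v.
  apply: (cross_inj hu hv); apply: (mulfI hl); apply: (mulfI hm); rewrite /detv !mulr0.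
  transitivity (l * (redv p (cvec u)).1 * (m * (redv p (cvec v)).2) -
                l * (redv p (cvec u)).2 * (m * (redv p (cvec v)).1))%R; first by ring.
  by rewrite e1 e2; ring.
by subst v; congr (_, _); exact: (mulIf (den_neq0 hu)).
Qed.

Lemma card_line_set : #|line_set| = (p - 1) * size W ^ t.
Proof.
rewrite cardsE (card_uniqP uniq_line_seq) size_allpairs size_concats -cardE cardC1.
by rewrite card_Fp // subn1.
Qed.

Lemma card_rot_set : #|rot_set| = #|line_set|.
Proof.
have inj : injective (fun v : vec F => (v.2, - v.1)%R).
  move=> [a b] [c d] e; have e1 : b = d := congr1 fst e.
  have e2 : (- a = - c)%R := congr1 snd e.
  by rewrite e1 (oppr_inj e2).
rewrite -(card_imset (mem line_set) inj); apply: eq_card => v; rewrite inE.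
apply/idP/imsetP => [h|[u hu ->]]; last by rewrite /= opprK -surjective_pairing.
by exists (- v.2, v.1)%R => //=; rewrite opprK -surjective_pairing.
Qed.

Lemma line_set0 : (0 \notin line_set)%R.
Proof.
rewrite inE; apply/negP => /allpairsP[[l w] /= [hl hw e]].
have /eqP : (l * (redv p (cvec w)).2 = 0)%R := esym (congr1 snd e).
by rewrite mulf_eq0 (negPf (den_neq0 hw)) orbF; move: hl; rewrite mem_enum inE => /negPf ->.
Qed.

Lemma rot_set0 : (0 \notin rot_set)%R.
Proof. by rewrite in_set /= oppr0; exact: line_set0. Qed.

Lemma line_set_hom (l : F) v : (l != 0)%R -> (scalev l v \in line_set) = (v \in line_set).
Proof.
have half (m : F) u : (m != 0)%R -> u \in line_set -> scalev m u \in line_set.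
  move=> m0; rewrite !inE => /allpairsP[[k w] /= [hk hw ->]]; apply/allpairsP.
  exists (m * k, w)%R; split=> //; first by move: hk; rewrite !mem_enum !inE => hk; exact: mulf_neq0.
  by rewrite /scalev /= !mulrA.
move=> l0; apply/idP/idP; last exact: half.
move=> /(half l^-1)%R; rewrite invr_neq0 // => /(_ isT).
by rewrite /scalev /= !mulKf // -surjective_pairing.
Qed.

Lemma rot_set_hom (l : F) v : (l != 0)%R -> (scalev l v \in rot_set) = (v \in rot_set).
Proof.
move=> l0; rewrite [LHS]in_set [RHS]in_set -(line_set_hom (- v.2, v.1)%R l0).
by rewrite /scalev /= mulrN.
Qed.
End Lines.

(** * The dichotomy *)

(* A final letter [1] is merged into its predecessor by [partial_quotients], hence [Q.+1]. *)
Lemma cf_aux_bound Q w fuel a q : all (fun b => 0 < b <= Q) w -> cfrac w = (a, q) ->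
  all (fun b => b <= Q.+1) (cf_aux fuel a q).
Proof.
elim: w fuel a q => [|b w IH] [|fuel] a q //=; first by move=> _ [<- _].
move=> /andP[/andP[b0 bQ] hw]; rewrite /cfrac /=.
have := cfrac_prop (pos_le hw); have := IH fuel _ _ hw.
rewrite /cfrac; case: (cfv w (0, 1)) => a' q' /= {}IH [q0 aq _ _ _] [<- <-].
case: q' q0 aq IH => // q' _ aq IH.
have [lt|ge] := ltnP a' q'.+1.
  have e1 : (b * q'.+1 + a' = q'.+1 * b + a')%coq_nat by lia.
  rewrite -(PeanoNat.Nat.div_unique _ _ _ _ (ssrnat.ltP lt) e1) -(PeanoNat.Nat.mod_unique _ _ _ _ (ssrnat.ltP lt) e1).
  by rewrite /= leqW // IH.
have ea : a' = q'.+1 by apply/eqP; rewrite eqn_leq aq ge.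
have e1 : (b * q'.+1 + a' = q'.+1 * b.+1 + 0)%coq_nat by rewrite ea; lia.
have lt : (0 < q'.+1)%coq_nat by apply/ssrnat.ltP.
rewrite -(PeanoNat.Nat.div_unique _ _ _ _ lt e1) -(PeanoNat.Nat.mod_unique _ _ _ _ lt e1).
by rewrite /= ltnS bQ; case: (fuel).
Qed.

Section Dichotomy.
Variables (p s Q : nat) (W : seq (seq nat)) (r i : nat).
Local Notation k := (2 ^ i).
Local Notation L := (2 * Q).
Local Notation w := (size W).
Local Notation N := (L ^ (2 * r)).
Local Notation S := ((2 * N) ^ (2 * (2 * k))).
Hypothesis pr : prime p.
Hypothesis p3 : 3 <= p.
Hypothesis W_ok : block_ok s Q W.
Hypothesis Q0 : 0 < Q.
Hypothesis p_gt : L ^ (2 * (r * k)) < p.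

Definition good_fraction (M : nat) := exists a q,
  [/\ 0 < a < q, coprime a q, p %| q, q <= M & all (fun b => b <= Q.+1) (partial_quotients a q)].

Local Notation A := (map matw (concats W (2 * r))).

(** The number [2 * r] of blocks is even, so every word has even length. *)
Lemma detA a : a \in A -> detm a = 1%R.
Proof.
move=> /mapP[u hu ->]; have [su _ _] := concatsP W_ok hu.
by rewrite detm_matw su mulnCA exprM sqrrN !expr1n.
Qed.

(* The denominator of [rev v ++ m ++ u] is the pairing of [cvec v] with [matw m] applied to [cvec u]. *)
Lemma solution u v m (l l' : 'F_p) : u \in concats W (r * k) -> v \in concats W (r * k) ->
  m \in concats W (2 * r) -> (l != 0)%R ->
  let y := mulv (redm p (matw m)) (scalev l (redv p (cvec u))) in
  (- y.2, y.1)%R = scalev l' (redv p (cvec v)) ->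
  good_fraction (4 * (p * N)).
Proof.
move=> hu hv hm l0 y ey; pose z := rev v ++ m ++ u.
have [_ au nu] := concatsP W_ok hu; have [_ av nv] := concatsP W_ok hv.
have [_ am nm] := concatsP W_ok hm.
have az : all (fun b => 0 < b <= Q) z by rewrite !all_cat all_rev au av am.
have pz := pos_le az; have := cfrac_prop pz.
case ez : (cfrac z) => [a q] [q0 aq cp e _].
have hz : mulv (matw z) (0, 1)%R = (Posz a, Posz q).
  by have := matwE z 0 1; rewrite -/(cfrac z) ez.
have hq : (Posz q = (cvec v).1 * (mulv (matw m) (cvec u)).1 + (cvec v).2 * (mulv (matw m) (cvec u)).2)%R.
  have cu : cvec u = mulv (matw u) (0, 1)%R by rewrite (matwE u 0 1).
  have cv : cvec v = mulv (matw v) (0, 1)%R by rewrite (matwE v 0 1).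
  have := congr1 snd hz; rewrite /z !matw_cat matw_rev !mulmv -cu cv /= => <-.
  by rewrite !mulr0 !mulr1 !add0r.
have pq : p %| q.
  suff : (Posz p %| Posz q)%Z by [].
  have hq' : ((Posz q)%:~R = ((cvec v).1)%:~R * ((mulv (matw m) (cvec u)).1)%:~R +
      ((cvec v).2)%:~R * ((mulv (matw m) (cvec u)).2)%:~R :> 'F_p)%R by rewrite hq rmorphD !rmorphM.
  rewrite -(intr_Fp_eq0 pr) hq'; apply/eqP.
  have y1 : (y.1 = l' * ((cvec v).2)%:~R)%R := congr1 snd ey.
  have y2 : (- y.2 = l' * ((cvec v).1)%:~R)%R := congr1 fst ey.
  have yE : y = scalev l (redv p (mulv (matw m) (cvec u))) by rewrite redv_mul /y mulv_scale.
  have z1 : (y.1 = l * ((mulv (matw m) (cvec u)).1)%:~R)%R by rewrite yE.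
  have z2 : (y.2 = l * ((mulv (matw m) (cvec u)).2)%:~R)%R by rewrite yE.
  apply: (mulfI l0); rewrite mulr0.
  transitivity (((cvec v).1)%:~R * y.1 + ((cvec v).2)%:~R * y.2)%R; first by rewrite z1 z2 mulrDr !(mulrCA l).
  by rewrite -[y.2]opprK y1 y2 mulrN [X in (X - _)%R]mulrCA [X in (_ - X)%R]mulrCA [X in (_ - _ * X)%R]mulrC subrr.
have q1 : 1 < q by rewrite (leq_trans (prime_gt1 pr)) // dvdn_leq.
exists a, q; split=> //.
- rewrite lt0n; apply/andP; split.
    rewrite e; apply: contraTneq q1 => z0; move: ez; rewrite z0 => -[_ <-].
    by rewrite ltnn.
  rewrite ltn_neqAle aq andbT; apply: contraTneq cp => ->.
  by rewrite /coprime gcdnn neq_ltn q1 orbT.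
(* Each of the two concatenations costs a factor 2, and the two outer words together have norm
   product at most L^(2 r k) < p. *)
- have nz : mnrm (matw z) <= 2 * (L ^ (r * k) * (2 * (N * L ^ (r * k)))).
    rewrite /z !matw_cat mnrm_mulm ?mnrm_mulm // matw_rev.
    by apply: leq_trans nv; rewrite /mnrm /nrm /trm /= maxnACA.
  have : q <= mnrm (matw z).
    have /= := congr1 snd hz; rewrite mulr0 add0r mulr1 => e2.
    by rewrite -(absz_nat q) -e2 /mnrm /nrm !leq_max leqnn !orbT.
  move=> /leq_trans /(_ nz) h; apply: (leq_trans h).
  have := ltnW p_gt; rewrite [2 * (r * k)]mul2n -addnn expnD => hp.
  have -> : 2 * (L ^ (r * k) * (2 * (N * L ^ (r * k)))) = 4 * (L ^ (r * k) * L ^ (r * k) * N) by ring.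
  by rewrite leq_mul2l leq_mul2r hp !orbT.
- exact: cf_aux_bound az ez.
Qed.

Lemma count_bound tau :
  (forall n, 0 < n -> n <= S ^ 2 + 1 -> size (divisors n) <= tau) ->
  count (congr1m p) (prods (quotients A) (2 * k)) * p ^ 3 <=
  (192 * N * (2 * r * w).+1) ^ (4 * k) *
    (p ^ 3 + 96 * tau.+1 * (p ^ 2 + S) * (8 * r * w * k).+1).
Proof.
move=> htau.
have N0 : 0 < N by rewrite expn_gt0 muln_gt0 Q0.
have uA : uniq A by rewrite map_inj_in_uniq ?(uniq_concats W_ok) //; apply: concats_matw_inj W_ok _.
have nA a : a \in A -> mnrm a <= N.
  by move=> /mapP[u hu ->]; have [_ _] := concatsP W_ok hu.
(* Only the logarithm of this size matters, so the crude w <= 2^w is enough and keeps the later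
   factor linear in [r]. *)
have szA : size A <= 2 ^ (2 * r * w).
  by rewrite size_map size_concats [2 * r * w]mulnC (expnM 2 w); case: (2 * r) => // j; rewrite leq_exp2r // ltnW // ltn_expl.
have c1 : contracting A (192 * N * (2 * r * w).+1)%:R.
  by move=> c c0; apply: sum_contract => //; exact: detA.
have c2 : contracting (map (@adjm _) A) (192 * N * (2 * r * w).+1)%:R.
  move=> c c0; apply: sum_contract => //.
  - by rewrite map_inj_uniq //; apply: inv_inj; exact: adjmK.
  - by move=> _ /mapP[a ha ->]; rewrite detm_adj detA.
  - by move=> _ /mapP[a ha ->]; rewrite mnrm_adj nA.
  - by rewrite size_map.
have dA : all (fun a => detm a == 1%R) A by apply/allP => a /detA ->.
move: (192 * N * _)%N c1 c2 => K c1 c2.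
have := @count_congr_prods (prods (quotients A) (2 * k)) (K%:R ^+ (2 * (2 * k)))%R p S tau (8 * r * w * k).
move=> /(_ p3 (exprn_ge0 _ (ler0n _ _)) (fun z => @detm_prods _ A _ z dA)).
move=> /(_ (@mnrm_prods A N N0 nA (2 * k)) htau).
move=> /(_ (@count_prods _ (ler0n _ _) _ c1 c2 detA (2 * k))).
have hs : size (prods (quotients A) (2 * k)) <= 2 ^ (8 * r * w * k).
  rewrite size_prods; apply: (leq_trans (n := (2 ^ (2 * r * w)) ^ (2 * (2 * k)))).
    by rewrite leq_exp2r // !muln_gt0 expn_gt0.
  by rewrite -expnM leq_exp2l //; apply/eq_leq; ring.
move=> /(_ hs); move: (96 * _ * _ * _)%N => D.
have p30 : (0 < (p ^ 3)%:R :> rat)%R by rewrite ltr0n expn_gt0 (leq_trans _ p3).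
move=> h; rewrite -(ler_nat rat) natrM.
rewrite -(ler_pM2r p30) in h; apply: (le_trans h).
rewrite (_ : 4 * k = 2 * (2 * k)); last by ring.
rewrite le_eqVlt; apply/orP; left; apply/eqP.
rewrite [RHS]natrM !natrX natrD natrX -[LHS]mulrA; congr (_ * _)%R.
by rewrite mulrDl mul1r divfK // -natrX gt_eqF.
Qed.

Lemma dichotomy tau :
  (forall n, 0 < n -> n <= S ^ 2 + 1 -> size (divisors n) <= tau) ->
  good_fraction (4 * (p * N)) \/
  w ^ (4 * r * k * (2 + k)) * p ^ 3 <=
  2 * p ^ 2 * (p + 1) ^ (4 * k) * ((192 * N * (2 * r * w).+1) ^ (4 * k) *
    (p ^ 3 + 96 * tau.+1 * (p ^ 2 + S) * (8 * r * w * k).+1)).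
Proof.
move=> htau.
pose X := line_set p W (r * k); pose Y := rot_set p W (r * k).
(* A matrix carrying a point of [X] into [Y] yields a fraction; otherwise [avoid_bound] applies. *)
have [hav|] := boolP (all (fun a => [forall v, (v \in X) ==> (mulv a v \notin Y)]) (map (redm p) A)); last first.
  move=> /allPn[g /mapP[_ /mapP[m hm ->] ->]]; rewrite negb_forall => /existsP[x].
  rewrite negb_imply negbK => /andP[]; rewrite in_set => /allpairsP[[l u] /= [hl hu ->]].
  rewrite !in_set => /allpairsP[[l' v] /= [hl' hv ey]]; left.
  by apply: (solution hu hv hm _ ey); move: hl; rewrite mem_enum inE.
right.
have dA : all (fun a => detm a == 1%R) (map (redm p) A).
  by apply/allP => _ /mapP[a /detA da ->]; rewrite detm_red da.
have := @avoid_bound 'F_p (map (redm p) A) X Y dA (@rot_set_hom p W (r * k)) (line_set0 pr W_ok Q0 p_gt)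
  (rot_set0 pr W_ok Q0 p_gt) _ i.
have hv a v : a \in map (redm p) A -> v \in X -> mulv a v \notin Y.
  by move=> ha hx; have /forallP/(_ v)/implyP := allP hav _ ha; exact.
move=> /(_ hv); rewrite count_prods_red // card_rot_set !(card_line_set pr W_ok Q0 p_gt).
have := count_bound htau; move: (_ * (_ + _))%N => B.
rewrite !size_map size_concats card_Fp //; set n := count _ _ => hn h.
have p1 : 0 < p - 1 by rewrite subn_gt0 prime_gt1.
have e1 : ((w ^ (2 * r)) ^ 2 * ((p - 1) * w ^ (r * k)) * ((p - 1) * w ^ (r * k))) ^ (2 * k) =
    (p - 1) ^ (4 * k) * w ^ (4 * r * k * (2 + k)).
  have -> : (w ^ (2 * r)) ^ 2 * ((p - 1) * w ^ (r * k)) * ((p - 1) * w ^ (r * k)) =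
            (p - 1) ^ 2 * w ^ (2 * r * 2 + r * k * 2).
    by rewrite expnD !expnM; ring.
  by rewrite expnMn -!expnM; congr (_ ^ _ * _ ^ _); ring.
have e2 : p ^ 2 - 1 = (p - 1) * (p + 1) by rewrite -{2}(exp1n 2) subn_sqr.
move: h; rewrite e1 e2 expnMn.
rewrite (_ : _ * ((p - 1) ^ (4 * k) * _) = (p - 1) ^ (4 * k) * (2 * p ^ 2 * n * (p + 1) ^ (4 * k))); last by ring.
rewrite leq_pmul2l ?expn_gt0 ?p1 // => h.
apply: (leq_trans (leq_mul h (leqnn (p ^ 3)))).
rewrite (_ : _ * p ^ 3 = 2 * p ^ 2 * (p + 1) ^ (4 * k) * (n * p ^ 3)); last by ring.
by rewrite leq_mul2l hn orbT.
Qed.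
End Dichotomy.

(** * Comparison of exponents *)

Section PolyDominated.
Variables (I : Type) (P : I -> Prop) (r : I -> nat).
Implicit Types f g h : I -> nat.

(* [f <= g] up to a factor polynomial in [r]; the quantities compared below are exponential in [r]. *)
Definition dominated f g := exists C e, forall i, P i -> f i <= C * (r i).+1 ^ e * g i.
Local Notation "f <~ g" := (dominated f g) (at level 70).

Lemma dom_le f g : (forall i, P i -> f i <= g i) -> f <~ g.
Proof. by move=> h; exists 1, 0 => i /h; rewrite expn0 !mul1n. Qed.

Lemma dom_trans g f h : f <~ g -> g <~ h -> f <~ h.
Proof.
move=> [C [e hf]] [C' [e' hg]]; exists (C * C'), (e + e') => i Pi.
apply: (leq_trans (hf _ Pi)); apply: (leq_trans (leq_mul (leqnn _) (hg _ Pi))).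
by rewrite expnD; apply/eq_leq; ring.
Qed.

Lemma dom_eqr f g h : f <~ g -> g =1 h -> f <~ h.
Proof. by move=> [C [e hf]] gh; exists C, e => i Pi; rewrite -gh hf. Qed.

Lemma dom_eql f g h : g <~ h -> f =1 g -> f <~ h.
Proof. by move=> [C [e hf]] gh; exists C, e => i Pi; rewrite gh hf. Qed.

Lemma dom_mul f g f' g' : f <~ g -> f' <~ g' -> (fun i => f i * f' i) <~ (fun i => g i * g' i).
Proof.
move=> [C [e hf]] [C' [e' hg]]; exists (C * C'), (e + e') => i Pi.
apply: (leq_trans (leq_mul (hf _ Pi) (hg _ Pi))).
by rewrite expnD; apply/eq_leq; ring.
Qed.

Lemma dom_exp n f g : f <~ g -> (fun i => f i ^ n) <~ (fun i => g i ^ n).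
Proof.
move=> h; elim: n => [|n IH]; first by apply: dom_le.
by apply: dom_eql (dom_eqr (dom_mul h IH) _) _ => i; rewrite expnS.
Qed.

Lemma dom_add f f' g : f <~ g -> f' <~ g -> (fun i => f i + f' i) <~ g.
Proof.
move=> [C [e hf]] [C' [e' hg]]; exists (C + C'), (e + e') => i Pi.
apply: (leq_trans (leq_add (hf _ Pi) (hg _ Pi))).
rewrite -mulnDl leq_mul2r mulnDl leq_add ?orbT // leq_mul2l leq_pexp2l ?orbT //.
  exact: leq_addr.
exact: leq_addl.
Qed.

Lemma dom_cst c f g : f <~ g -> (fun i => c * f i) <~ g.
Proof.
move=> [C [e hf]]; exists (c * C), e => i Pi.
by rewrite -!mulnA leq_mul2l mulnA hf ?orbT.
Qed.

Lemma dom_lin c f g : f <~ g -> (fun i => (c * r i).+1 * f i) <~ g.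
Proof.
move=> [C [e hf]]; exists (c.+1 * C), e.+1 => i Pi.
rewrite expnS (_ : _ * g i = (c.+1 * (r i).+1) * (C * (r i).+1 ^ e * g i)); last by ring.
by rewrite leq_mul ?hf //; lia.
Qed.
End PolyDominated.

Lemma exp2_not_dominated C e : exists n0, forall n, n0 <= n -> C * n.+1 ^ e < 2 ^ n.
Proof.
exists (C * e.+1 ^ e.+1) => n hn.
have h := expnS_le_exp2 e.+1 n; rewrite expnS in h.
have e0 : 0 < e.+1 ^ e.+1 by rewrite expn_gt0.
rewrite -(ltn_pmul2l e0); apply: leq_trans h.
rewrite mulnA [_ * C]mulnC ltn_mul2r expn_gt0 /= ltnS //.
Qed.

Section Numeric.
Variables (L w k Ct : nat).
Local Notation D := (4 * k + 9).
Hypothesis L2 : 2 <= L.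
Hypothesis k0 : 0 < k.
(* With [T = L ^ r], this choice of [D] leaves a surplus of [T ^ (16 k)] after raising to the power [16 D]. *)
Hypothesis hw : L ^ (2 * D - 1) <= w ^ D.
Local Notation N r := (L ^ (2 * r)).
Local Notation S r := ((2 * N r) ^ (2 * (2 * k))).

(** Put T = L^r. Up to factors polynomial in r, p is T^(2k), N is T^2, S is T^(8k) and tau is at
    most T^k. The right side is at most T^(8k^2 + 21k), the left at least T^(8k^2 + 22k - 4k(k +
    2)/D). For D = 4k + 9 the left exponent exceeds the right by k/D. *)
Lemma counting_contradiction : exists r0, forall r p tau, r0 <= r ->
  L ^ (2 * (r * k)) < p -> p <= L ^ (2 * (r.+1 * k)) -> tau ^ 16 <= Ct * (S r ^ 2 + 1) ->
  ~ (w ^ (4 * r * k * (2 + k)) * p ^ 3 <=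
  2 * p ^ 2 * (p + 1) ^ (4 * k) * ((192 * N r * (2 * r * w).+1) ^ (4 * k) *
    (p ^ 3 + 96 * tau.+1 * (p ^ 2 + S r) * (8 * r * w * k).+1))).
Proof.
pose I := (nat * nat * nat)%type.
pose r (i : I) := i.1.1; pose p (i : I) := i.1.2; pose tau (i : I) := i.2.
pose T (i : I) := L ^ r i.
pose G (i : I) := w ^ (4 * r i * k * (2 + k)).
pose P i := [/\ L ^ (2 * (r i * k)) < p i, p i <= L ^ (2 * ((r i).+1 * k)),
  tau i ^ 16 <= Ct * (S (r i) ^ 2 + 1) &
  G i * p i ^ 3 <= 2 * p i ^ 2 * (p i + 1) ^ (4 * k) * ((192 * N (r i) * (2 * r i * w).+1) ^ (4 * k) *
    (p i ^ 3 + 96 * (tau i).+1 * (p i ^ 2 + S (r i)) * (8 * r i * w * k).+1))].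
pose dom := dominated P r.
have L0 : 0 < L by apply: leq_trans L2.
have T0 i : 0 < T i by rewrite expn_gt0 L0.
have TX i a b : a <= b -> T i ^ a <= T i ^ b by move=> h; rewrite leq_pexp2l.
have eq_dom f g : (forall i, f i = g i) -> dom f g by move=> h; apply: dom_le => i _; rewrite h.
have hN i : N (r i) = T i ^ 2 by rewrite /T -expnM mulnC.
(* The gap between the bounds with [r] and with [r.+1] is the constant factor L^(2k). *)
have dp : dom p (fun i => T i ^ (2 * k)).
  exists (L ^ (2 * k)), 0 => i [_ h _ _]; rewrite expn0 muln1; apply: (leq_trans h).
  by rewrite /T -expnM -expnD leq_exp2l //; apply/eq_leq; ring.
have d1 e : dom (fun _ => 1) (fun i => T i ^ e) by apply: dom_le => i _; rewrite expn_gt0 T0.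
have dp1 : dom (fun i => p i + 1) (fun i => T i ^ (2 * k)) by apply: dom_add (d1 _).
have dpn n : dom (fun i => p i ^ n) (fun i => T i ^ (2 * k * n)).
  by apply: (dom_eqr (dom_exp n dp)) => i; rewrite [RHS]expnM.
have dS : dom (fun i => S (r i)) (fun i => T i ^ (8 * k)).
  have : dom (fun i => 2 * N (r i)) (fun i => T i ^ 2).
    by apply: dom_cst; apply: eq_dom => i; exact: hN.
  move=> /(dom_exp (2 * (2 * k))) h; apply: (dom_eqr h) => i.
  by rewrite -expnM; congr (_ ^ _); ring.
have dK : dom (fun i => (192 * N (r i) * (2 * r i * w).+1) ^ (4 * k)) (fun i => T i ^ (8 * k)).
  have : dom (fun i => 192 * N (r i) * (2 * r i * w).+1) (fun i => T i ^ 2).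
    apply: (dom_trans (g := fun i => (2 * w * r i).+1 * (192 * N (r i)))).
      by apply: eq_dom => i; rewrite mulnC mulnAC.
    by apply: dom_lin; apply: dom_cst; apply: eq_dom => i; exact: hN.
  move=> /(dom_exp (4 * k)) h; apply: (dom_eqr h) => i.
  by rewrite -expnM; congr (_ ^ _); ring.
have up (f : I -> nat) a b : a <= b -> dom f (fun i => T i ^ a) -> dom f (fun i => T i ^ b).
  by move=> ab h; apply: (dom_trans h); apply: dom_le => i _; exact: TX.
pose t1 i := (tau i).+1.
have dB : dom (fun i => p i ^ 3 + 96 * (tau i).+1 * (p i ^ 2 + S (r i)) * (8 * r i * w * k).+1)
    (fun i => t1 i * T i ^ (8 * k)).
  apply: dom_add.
    apply: (dom_trans (g := fun i => 1 * p i ^ 3)); first by apply: eq_dom => i; rewrite mul1n.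
    apply: dom_mul; first by apply: dom_le.
    by apply: up (dpn 3); clear; lia.
  apply: (dom_trans (g := fun i => (8 * w * k * r i).+1 * (96 * (t1 i * (p i ^ 2 + S (r i)))))).
    apply: eq_dom => i; rewrite /t1 [RHS]mulnC -!mulnA; do 3 ! congr (_ * _).
    by congr (_.+1); ring.
  apply: dom_lin; apply: dom_cst; apply: dom_mul; first by apply: dom_le.
  by apply: dom_add dS; apply: up (dpn 2); clear; lia.
have dtau : dom (fun i => t1 i ^ 16) (fun i => T i ^ (16 * k)).
  have e1 : dom (fun i => tau i ^ 16) (fun i => T i ^ (16 * k)).
    apply: (dom_trans (g := fun i => Ct * (S (r i) ^ 2 + 1))).
      by apply: dom_le => i [].
    apply: dom_cst; apply: dom_add (d1 _).
    apply: (dom_eqr (dom_exp 2 dS)) => i.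
    by rewrite -expnM; congr (_ ^ _); ring.
  apply: (dom_trans (g := fun i => 2 ^ 16 * (tau i ^ 16 + 1))).
    apply: dom_le => i _; rewrite /t1; case: (posnP (tau i)) => [->|t0].
      by rewrite exp1n muln_gt0 expn_gt0 addn1.
    apply: (leq_trans (n := (2 * tau i) ^ 16)).
      by rewrite leq_exp2r // mul2n -addnn -addn1 leq_add2l.
    by rewrite expnMn leq_mul2l leq_addr orbT.
  by apply: dom_cst; apply: dom_add (d1 _).
have dmain : dom (fun i => G i * p i ^ 3) (fun i => T i ^ (20 * k + 8 * k ^ 2) * t1 i).
  apply: (dom_trans (g := fun i => 2 * (p i ^ 2 * (p i + 1) ^ (4 * k) *
      ((192 * N (r i) * (2 * r i * w).+1) ^ (4 * k) *
      (p i ^ 3 + 96 * (tau i).+1 * (p i ^ 2 + S (r i)) * (8 * r i * w * k).+1))))).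
    by apply: dom_le => i [_ _ _]; rewrite -!mulnA.
  apply: dom_cst.
  have := dom_mul (dom_mul (dpn 2) (dom_exp (4 * k) dp1)) (dom_mul dK dB).
  move=> h; apply: (dom_eqr h) => i.
  rewrite [t1 i * _]mulnC !mulnA; congr (_ * _).
  by rewrite -expnM -!expnD; congr (_ ^ _); ring.
have dG : dom (fun i => T i ^ (16 * k)) (fun _ => 1).
  (* The exponent clears denominators: 16 for the bound on [tau], [D] for [hw]. *)
  have h := dom_exp (16 * D) dmain.
  have [C [e hC]] : dom (fun i => (G i * p i ^ 3) ^ (16 * D))
     (fun i => T i ^ (16 * D * (20 * k + 8 * k ^ 2) + 16 * k * D)).
    apply: dom_trans h _.
    have h2 : dom (fun i => t1 i ^ (16 * D)) (fun i => T i ^ (16 * k * D)).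
      by apply: dom_eql (dom_eqr (dom_exp D dtau) _) _ => i; rewrite -expnM.
    have h3 := dom_mul (eq_dom _ _ (fun i => erefl (T i ^ (16 * D * (20 * k + 8 * k ^ 2))))) h2.
    apply: dom_eql (dom_eqr h3 _) _ => i; first by rewrite expnD.
    by rewrite expnMn -expnM; congr (_ ^ _ * _); ring.
  exists C, e => i Pi; rewrite muln1; have := hC i Pi.
  set X := 16 * D * (20 * k + 8 * k ^ 2) + 16 * k * D => {}hC.
  have TX0 : 0 < T i ^ X by rewrite expn_gt0 T0.
  rewrite -(leq_pmul2r TX0); apply: leq_trans hC.
  have [h1 _ _ _] := Pi.
  have gG : T i ^ ((2 * D - 1) * (64 * k * (2 + k))) <= G i ^ (16 * D).
    rewrite /G -expnM (_ : 4 * r i * k * (2 + k) * (16 * D) = D * (r i * (64 * k * (2 + k)))); last by ring.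
    rewrite [leqRHS]expnM; apply: (leq_trans (n := (L ^ (2 * D - 1)) ^ (r i * (64 * k * (2 + k))))).
      by rewrite /T -!expnM leq_exp2l //; apply/eq_leq; ring.
    by case: (r i * (64 * k * (2 + k))) => // j; rewrite leq_exp2r.
  have gp : T i ^ (96 * k * D) <= (p i ^ 3) ^ (16 * D).
    apply: (leq_trans (n := (L ^ (2 * (r i * k))) ^ (3 * (16 * D)))).
      by rewrite /T -!expnM leq_exp2l //; apply/eq_leq; ring.
    have e0 : 0 < 3 * (16 * D) by rewrite !muln_gt0 addn_gt0 orbT.
    by rewrite -[leqRHS]expnM (leq_exp2r _ _ e0); apply: ltnW.
  rewrite expnMn; apply: leq_trans (leq_mul gG gp).
  rewrite -!expnD; apply: TX; rewrite /X; clear.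
  have -> : 2 * D - 1 = 8 * k + 17 by lia.
  by apply/eq_leq; ring.
have [C [e hC]] := dG; have [n0 hn0] := exp2_not_dominated C e.
exists n0 => r' p' tau' hr h1 h2 h3 h4.
have Pi : P (r', p', tau') by split.
have := hC _ Pi; rewrite muln1 leqNgt => /negP; apply.
apply: (leq_trans (hn0 _ hr)); apply: (leq_trans (n := T (r', p', tau'))).
  by rewrite /T /r /=; case: (r') => // j; rewrite leq_exp2r.
by rewrite -{1}(expn1 (T _)) TX // muln_gt0.
Qed.
End Numeric.

(** * Existence of the fraction *)

Lemma partial_quotients1 p : partial_quotients 1 p = [:: p].
Proof.
transitivity (Nat.div p 1 :: cf_aux p (Nat.modulo p 1) 1); first by [].
by rewrite PeanoNat.Nat.div_1_r PeanoNat.Nat.mod_1_r; case: p.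
Qed.

(** The integer N plays the role of p^(1/2^i), which avoids real exponents. *)
Lemma bounded_quotients_mod i : exists z, forall p, prime p -> exists a q N,
  [/\ 0 < a < q, coprime a q, p %| q & q <= z * p * N] /\
  N ^ (2 ^ i) <= p /\ all (fun b => b <= z) (partial_quotients a q).
Proof.
pose k := 2 ^ i; have k0 : 0 < k by rewrite expn_gt0.
have [e [s [W [W_ok hW]]]] := dense_blocks (4 * k + 9).
have [Ct hCt] := divisors_sup 16.
set Q := 2 ^ e in W_ok; have Q0 : 0 < Q by rewrite expn_gt0.
pose L := 2 * Q; have L2 : 2 <= L by rewrite /L leq_pmulr.
have LW : L ^ (2 * (4 * k + 9) - 1) <= size W ^ (4 * k + 9).
  by rewrite /L /Q -expnS -expnM.
have [r0 hr0] := counting_contradiction Ct L2 k0 LW.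
pose p0 := (L ^ (2 * (r0.+1 * k))).+2.
(* The summands serve the factor 4 in the denominator bound, the partial quotients of the words, and
   the primes up to [p0], for which 1/p is taken. *)
exists (4 + Q.+1 + p0) => p pr; have [pp0|p0p] := leqP p p0.
  exists 1, p, 1; rewrite partial_quotients1 exp1n; split; last by rewrite prime_gt0 //= (leq_trans pp0) ?leq_addl.
  by split; rewrite ?prime_gt1 ?coprime1n // muln1 leq_pmull.
have p3 : 3 <= p by apply: leq_trans p0p; rewrite /p0.
pose B := L ^ (2 * k).
have B1 : 1 < B by rewrite -(expn0 L) ltn_exp2l // muln_gt0.
have LB j : L ^ (2 * (j * k)) = B ^ j by rewrite /B -expnM; congr (_ ^ _); ring.
(* The logarithm of p - 1 makes the lower bound B^r < p strict. *)
pose r := trunc_log B p.-1.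
have /andP[rlo rhi] : B ^ r <= p.-1 < B ^ r.+1 by apply: trunc_log_bounds => //; lia.
have p_gt : L ^ (2 * (r * k)) < p by rewrite LB; lia.
have p_le : p <= L ^ (2 * (r.+1 * k)) by rewrite LB; lia.
have r0r : r0 <= r.
  rewrite -ltnS -(ltn_exp2l _ _ B1); apply: leq_ltn_trans rhi.
  have : B ^ r0 <= B ^ r0.+1 by rewrite leq_exp2l.
  by move: p0p; rewrite /p0 LB; lia.
pose S := (2 * L ^ (2 * r)) ^ (2 * (2 * k)).
have [tau htau tauS] := hCt (S ^ 2 + 1) (ltn_addl _ (ltnSn 0)).
have [|/(hr0 _ _ _ r0r p_gt p_le tauS)//] := dichotomy pr p3 W_ok Q0 p_gt htau.
move=> [a [q [aq cp pq qM hb]]]; exists a, q, (L ^ (2 * r)); split; last split.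
- by split=> //; apply: (leq_trans qM); rewrite mulnA leq_mul2r leq_mul2r -addnA leq_addr !orbT.
- by apply: leq_trans (ltnW p_gt); rewrite -expnM leq_exp2l //; apply/eq_leq; rewrite -/k; ring.
- by apply: sub_all hb => b /leq_trans -> //; rewrite -addnA addnCA leq_addr.
Qed.

(** * Passage to the standard library and to real exponents *)

Lemma prime_of_Z p : Znumtheory.prime (BinInt.Z.of_nat p) -> prime p.
Proof.
move=> pr; have [p1 _] := pr; apply/primeP; split; first by lia.
move=> d /dvdnP[c hc]; have : BinInt.Z.divide (BinInt.Z.of_nat d) (BinInt.Z.of_nat p).
  by exists (BinInt.Z.of_nat c); rewrite hc; lia.
move=> /(Znumtheory.prime_divisors _ pr) [|[|[|]]] h; apply/orP.
- by exfalso; lia.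
- by left; lia.
- by right; lia.
- by exfalso; lia.
Qed.

Lemma gcd_coprime a q : coprime a q -> PeanoNat.Nat.gcd a q = 1.
Proof.
move=> cp; have [c hc] := PeanoNat.Nat.gcd_divide_l a q.
have [d hd] := PeanoNat.Nat.gcd_divide_r a q.
apply/eqP; rewrite -dvdn1 -(eqP cp) dvdn_gcd.
by apply/andP; split; apply/dvdnP; [exists c | exists d].
Qed.

Lemma bounded_quotients_mod_stdlib i : exists z : nat, forall p : nat,
  Znumtheory.prime (BinInt.Z.of_nat p) -> exists q a N : nat,
  (0 < a)%coq_nat /\ (a < q)%coq_nat /\ PeanoNat.Nat.gcd a q = 1 /\
  (q <= Nat.mul (Nat.mul z p) N)%coq_nat /\ (Nat.pow N (Nat.pow 2 i) <= p)%coq_nat /\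
  Nat.modulo q p = 0 /\ (forall b, List.In b (partial_quotients a q) -> (b <= z)%coq_nat).
Proof.
have [z hz] := bounded_quotients_mod i; exists z => p /prime_of_Z pr.
have [a [q [N [[/andP[a0 aq] cp /dvdnP[c hc] qM] [hN hb]]]]] := hz p pr.
have powE x n : Nat.pow x n = x ^ n by elim: n => //= n ->; rewrite expnS.
exists q, a, N; split; first exact/ssrnat.leP.
split; first exact/ssrnat.leP.
split; first exact: gcd_coprime.
split; first exact/ssrnat.leP.
split; first by rewrite !powE; exact/ssrnat.leP.
split.
  rewrite hc; apply: PeanoNat.Nat.Div0.mod_mul.
elim: (partial_quotients a q) hb => //= x t IH /andP[xz /IH h] b [<-|/h//].
exact/ssrnat.leP.
Qed.

End BoundedQuotients.

Theorem theorem5 :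
  forall eps : R, 0 < eps <= 1 ->
  exists zeta C : R,
    forall p : nat, prime (Z.of_nat p) ->
      exists q a : nat,
        (0 < a)%nat /\ (a < q)%nat /\ Nat.gcd a q = 1%nat /\
        INR q <= C * Rpower (INR p) (1 + eps) /\
        (q mod p = 0)%nat /\
        (forall b, In b (partial_quotients a q) -> INR b <= zeta).
Proof.
intros eps [eps0 _].
destruct (archimed_cor1 eps eps0) as [i [hi i0]].
destruct (BoundedQuotients.bounded_quotients_mod_stdlib i) as [z hz].
exists (INR z), (INR z); intros p pr.
destruct (hz p pr) as (q & a & N & a0 & aq & cp & qM & hN & pq & hb).
exists q, a; repeat split; auto.
2: intros b hb'; apply le_INR; auto.
assert (p1 : 1 <= INR p).
{ destruct pr as [pr _]; change 1 with (INR 1); apply le_INR; lia. }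
(* From N^k <= p with k = 2^i >= i and 1/i < eps. The value N = 0 is split off because N is
   rewritten as a real power. *)
assert (hNp : INR N <= Rpower (INR p) eps).
{ destruct (Nat.eq_dec N 0) as [->|N0].
  { simpl; left; apply exp_pos. }
  assert (Np : 0 < INR N) by (apply lt_0_INR; lia).
  set (k := (2 ^ i)%nat) in *.
  assert (ik : (i <= k)%nat) by (apply Nat.lt_le_incl, Nat.pow_gt_lin_r; lia).
  assert (k0 : 0 < INR k) by (apply lt_0_INR; lia).
  replace (INR N) with (Rpower (INR (N ^ k)) (/ INR k)).
  { apply Rle_trans with (Rpower (INR p) (/ INR k)).
    { apply Rle_Rpower_l; [left; apply Rinv_0_lt_compat; lra|split].
      { rewrite pow_INR; apply pow_lt; lra. }
      { apply le_INR; exact hN. } }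
    apply Rle_Rpower; [lra|].
    apply Rle_trans with (/ INR i); [|lra].
    apply Rinv_le_contravar; [apply lt_0_INR; lia | apply le_INR; lia]. }
  rewrite pow_INR, <- Rpower_pow, Rpower_mult by lra.
  rewrite Rinv_r, Rpower_1 by lra; reflexivity. }
apply Rle_trans with (INR (z * p * N)); [apply le_INR; exact qM|].
rewrite !mult_INR, Rpower_plus, Rpower_1, Rmult_assoc by lra.
apply Rmult_le_compat_l; [apply pos_INR|].
apply Rmult_le_compat_l; lra.
Qed.
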